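(* Let $\omega:[0,1]\to\mathbb{R}$ be continuous (and nonconstant), with associated tree $\mathbb{T}$ and length measure $\lambda$, and for a bounded Borel function $\rho:[0,1]\to\mathbb{R}$ let $\Delta\rho(\tau)=\rho(\tau^\nearrow)-\rho(\tau^\nwarrow)$, $\tau\in\mathbb{T}$, with the conventions of the context. (a) For $p,q\ge1$ with $1/p+1/q>1$ there is a constant $C=C(p,q)$ such that $$\int_{\mathbb{T}}|\Delta\rho(\tau)|\,\lambda(d\tau)\le C\,V_p(\omega)^{1/p}\bigl(V_q(\rho)^{1/q}+\sup|\rho|\bigr).$$ Thus $\int_{\mathbb{T}}|\Delta\rho|\,d\lambda<\infty$ as soon as $1/\mathcal{V}(\omega)+1/\mathcal{V}(\rho)>1$, and in this case one can define $$\int_0^1\rho\,d\omega:=\int_{\mathbb{T}}\Delta\rho(\tau)\,\lambda(d\tau).$$ Assume from now on that $1/\mathcal{V}(\omega)+1/\mathcal{V}(\rho)>1$. (b) For $1/p+1/q>1$, $$\Bigl|\int_0^1\rho\,d\omega\Bigr|\le C\,V_p(\omega)^{1/p}\bigl(V_q(\rho)^{1/q}+\sup|\rho|\bigr),\qquad C=C(p,q).$$ (c) This integral coincides with the Riemann--Stieltjes (Young) integral: $\int_0^1\rho\,d\omega=\lim\sum_i\rho(s_i)\bigl(\omega(t_{i+1})-\omega(t_i)\bigr)$, for $t_i\le s_i\le t_{i+1}$, as the mesh of the subdivision $(t_i)$ of $[0,1]$ tends to $0$. (d) For $0\le s\le t\le1$, the integral $\int_s^t\rho\,d\omega$ can be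 defined similarly by replacing $\rho$ by $\rho1_{(s,t]}$; it satisfies the Chasles relation $\int_s^t\rho\,d\omega=\int_s^u\rho\,d\omega+\int_u^t\rho\,d\omega$ for $s\le u\le t$, and, for $1/p+1/q>1$, $$V_p\Bigl(\int_0^{\cdot}\rho\,d\omega\Bigr)^{1/p}\le C\,V_p(\omega)^{1/p}\bigl(V_q(\rho)^{1/q}+\sup|\rho|\bigr),\qquad C=C(p,q).$$
   Context: For a continuous nonconstant $\omega:[0,1]\to\mathbb{R}$, put $\delta(s,t)=\omega(s)+\omega(t)-2\inf_{[s,t]}\omega$ ($[s,t]$ denotes the interval with endpoints $s,t$). This is a semi-distance on $[0,1]$; the quotient metric space $\mathbb{T}=([0,1]/\delta,\delta)$ is a compact real tree, i.e. any two points $\tau_1,\tau_2$ are joined by a unique arc $[\tau_1,\tau_2]$, isometric to $[0,\delta(\tau_1,\tau_2)]$. Let $\pi:[0,1]\to\mathbb{T}$ be the projection, $O=\pi(U)$ where $U$ is a time at which $\omega$ attains its minimum, $A=\pi(0)$, $B=\pi(1)$; one has $O\in[A,B]$. The tree is rooted at $O$; a leaf is a point $\tau$ such that $\tau\notin[O,\sigma]$ for all $\sigma\neq\tau$. The length measure $\lambda$ is the unique measure on $\mathbb{T}$ for which the set of leaves has measure zero and the measure of each arc is its length. Put $\tau^\nearrow=\inf\pi^{-1}(\tau)$, $\tau^\nwarrow=\sup\pi^{-1}(\tau)$. For $\rho:[0,1]\to\mathbb{R}$, the convention is that $\rho(\tau^\nearrow)$ is replaced by $0$ for $\tau\in[O,A]$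 and $\rho(\tau^\nwarrow)$ is replaced by $0$ for $\tau\in[O,B]$ (this corresponds to extending $\omega$ monotonically to $[-1,0]$ and $[1,2]$ down to its minimum, and $\rho$ by $0$). Thus, up to $\lambda$-null sets, $\Delta\rho(\tau)=\rho(\tau^\nearrow)-\rho(\tau^\nwarrow)$ on $\mathbb{T}\setminus[A,B]$, $\Delta\rho(\tau)=-\rho(\tau^\nwarrow)$ on $[A,O]$, $\Delta\rho(\tau)=\rho(\tau^\nearrow)$ on $[O,B]$, so that $$\int_{\mathbb{T}}\Delta\rho\,d\lambda=\int_{\mathbb{T}\setminus[A,B]}\bigl(\rho(\tau^\nearrow)-\rho(\tau^\nwarrow)\bigr)\lambda(d\tau)-\int_{[A,O]}\rho(\tau^\nwarrow)\lambda(d\tau)+\int_{[O,B]}\rho(\tau^\nearrow)\lambda(d\tau).$$ If $\omega(0)=\omega(1)=\inf\omega$, then $O=A=B$ and the convention is irrelevant. For $p\ge1$ and a real function $f$ on $[0,1]$, $V_p(f)=\sup\sum_i|f(t_{i+1})-f(t_i)|^p$ over subdivisions $(t_i)$ of $[0,1]$, and $\mathcal{V}(f)=\inf\{p\ge1:V_p(f)<\infty\}$. *)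

(* Defs.v *)
From HB Require Import structures.
From mathcomp Require Import all_boot all_order all_algebra lra.
From mathcomp Require Import all_classical all_reals all_analysis.
Set Implicit Arguments.
Unset Strict Implicit.
Unset Printing Implicit Defensive.
Import Order.TTheory GRing.Theory Num.Theory.
Import numFieldNormedType.Exports.
Local Open Scope classical_set_scope.
Local Open Scope ring_scope.

(* Functions on [0, 1] are represented by functions R -> R of which only the
   restriction to [0, 1] is ever used. *)

Record cpath (R : realType) := CPath {
  cpath_fun :> R -> R ;
  cpath_continuous : {within `[0, 1], continuous cpath_fun} ;
  cpath_nonconstant :
    exists s t, [/\ s \in `[0, 1], t \in `[0, 1] & cpath_fun s <> cpath_fun t]
}.

Section tree.
Context {R : realType} (w : cpath R).

Definition path_min (s t : R) : R :=
  inf (w @` `[Num.min s t, Num.max s t]).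

Definition delta (s t : R) : R := w s + w t - 2 * path_min s t.

Definition I01 := {t : R | t \in `[0, 1]}.

Lemma zero_in01 : (0 : R) \in `[0, 1]. Proof. by rewrite in_itv /= lexx ler01. Qed.
Lemma one_in01 : (1 : R) \in `[0, 1]. Proof. by rewrite in_itv /= lexx ler01. Qed.

Definition zero01 : I01 := exist _ 0 zero_in01.
Definition one01 : I01 := exist _ 1 one_in01.

Lemma cpath_argmin : exists t : I01, forall s : I01, w (val t) <= w (val s).
Proof.
have [c c01 cP] := EVT_min ler01 (@cpath_continuous _ w).
by exists (exist _ c c01) => s; apply: cP; exact: (valP s).
Qed.

Lemma path_min_le (s t x : R) : s \in `[0, 1] -> t \in `[0, 1] ->
  Num.min s t <= x <= Num.max s t -> path_min s t <= w x.
Proof.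
move=> s01 t01 xst; have [m mP] := cpath_argmin.
apply: ge_inf; last by exists x => //=; rewrite in_itv.
exists (w (val m)) => _ [y /= + <-]; rewrite in_itv /= => /andP[sy yt].
suff y01 : y \in `[0, 1] by exact: (mP (exist _ y y01)).
move: s01 t01; rewrite !in_itv /= => /andP[s0 s1] /andP[t0 t1].
rewrite (le_trans _ sy) ?le_min ?s0 ?t0//=.
by rewrite (le_trans yt)// ge_max s1 t1.
Qed.

Lemma le_path_min (s t y : R) :
  (forall x, Num.min s t <= x <= Num.max s t -> y <= w x) -> y <= path_min s t.
Proof.
move=> yP; apply: lb_le_inf.
  by exists (w s), s => //=; rewrite in_itv /= ge_min le_max lexx.
by move=> _ [x /= + <-]; rewrite in_itv /=; exact: yP.
Qed.

Lemma deltaC (s t : R) : delta s t = delta t s.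
Proof. by rewrite /delta /path_min minC maxC [w s + _]addrC. Qed.

Lemma deltaxx (s : R) : s \in `[0, 1] -> delta s s = 0.
Proof.
move=> s01; rewrite /delta; suff -> : path_min s s = w s by lra.
apply/eqP; rewrite eq_le; apply/andP; split.
  by apply: path_min_le; rewrite // minxx maxxx lexx.
by apply: le_path_min => x; rewrite minxx maxxx => /le_anti ->.
Qed.

Lemma delta_triangle (s t u : R) : s \in `[0, 1] -> t \in `[0, 1] ->
  u \in `[0, 1] -> delta s u <= delta s t + delta t u.
Proof.
move=> s01 t01 u01.
have H : Num.min (path_min s t) (path_min t u) <= path_min s u.
  apply: le_path_min => x /andP[]; rewrite ge_min le_max => x1 x2.
  suff [h|h] : Num.min s t <= x <= Num.max s t \/
               Num.min t u <= x <= Num.max t u.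
  - by rewrite ge_min path_min_le.
  - by rewrite ge_min orbC path_min_le.
  rewrite !ge_min !le_max.
  case: (lerP t x) => [tx|/ltW xt]; rewrite ?tx ?xt ?orbT ?andbT /=.
    by case/orP: x2 => ->; [left|right]; rewrite ?orbT.
  by case/orP: x1 => ->; [left|right]; rewrite ?orbT.
have Hst : path_min s t <= w t.
  by apply: path_min_le => //; rewrite ge_min le_max !lexx !orbT.
have Htu : path_min t u <= w t.
  by apply: path_min_le => //; rewrite ge_min le_max !lexx.
have {H} : path_min s t <= path_min s u \/ path_min t u <= path_min s u.
  by move: H; rewrite ge_min => /orP[]; [left|right].
rewrite /delta.
move: Hst Htu; move: (path_min s t) (path_min t u) (path_min s u) => a b c.
by move=> Ha Hb [Hc|Hc]; lra.
Qed.

Lemma delta_ge0 (s t : I01) : 0 <= delta (val s) (val t).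
Proof.
have := delta_triangle (valP s) (valP t) (valP s).
rewrite deltaxx ?(valP s)// [delta (val t) _]deltaC.
by rewrite -mulr2n pmulrn_lge0.
Qed.

Definition delta_rel : rel I01 := fun s t => delta (val s) (val t) == 0.

Lemma delta_rel_refl : reflexive delta_rel.
Proof. by move=> s; rewrite /delta_rel deltaxx// (valP s). Qed.

Lemma delta_rel_sym : symmetric delta_rel.
Proof. by move=> s t; rewrite /delta_rel deltaC. Qed.

Lemma delta_rel_trans : transitive delta_rel.
Proof.
move=> t s u /eqP st /eqP tu; rewrite /delta_rel eq_le delta_ge0 andbT.
by rewrite (le_trans (delta_triangle (valP s) (valP t) (valP u)))// st tu addr0.
Qed.

Canonical delta_equiv :=
  EquivRel delta_rel delta_rel_refl delta_rel_sym delta_rel_trans.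

Definition tree : Type := {eq_quot delta_equiv}%qT.

HB.instance Definition _ := Choice.on tree.

Definition tproj (t : I01) : tree := (\pi_({eq_quot delta_equiv}%qT) t)%qT.

HB.instance Definition _ := isPointed.Build tree (tproj zero01).

Definition tdist (a b : tree) : R :=
  delta (val (repr (a : {eq_quot delta_equiv}%qT)))
        (val (repr (b : {eq_quot delta_equiv}%qT))).

Lemma tdistxx (a : tree) : tdist a a = 0.
Proof. by apply: deltaxx; apply: valP. Qed.

Lemma tdist_positivity (a b : tree) : tdist a b = 0 -> a = b.
Proof.
move=> ab; rewrite -[a](@reprK _ {eq_quot delta_equiv}%qT).
rewrite -[b](@reprK _ {eq_quot delta_equiv}%qT).
by apply/eqmodP/eqP.
Qed.

Lemma tdist_sym (a b : tree) : tdist a b = tdist b a.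
Proof. exact: deltaC. Qed.

Lemma tdist_triangle (b a c : tree) : tdist a c <= tdist a b + tdist b c.
Proof. by apply: delta_triangle; apply: valP. Qed.

HB.instance Definition _ := @isMetric.Build R tree tdist tdistxx
  tdist_positivity tdist_sym tdist_triangle.

Lemma mdist_tproj (s t : I01) :
  mdist (tproj s) (tproj t) = delta (val s) (val t).
Proof.
have aux (u : I01) :
    delta (val u) (val (repr (tproj u : {eq_quot delta_equiv}%qT))) = 0.
  by apply/eqP; rewrite -/(delta_rel _ _); apply/eqmodP; rewrite reprK.
rewrite [LHS]/(tdist _ _) /tdist.
set s' := repr _; set t' := repr _.
have ss' := aux s; have tt' := aux t; rewrite -/s' -/t' in ss' tt'.
apply/eqP; rewrite eq_le; apply/andP; split.
  have := delta_triangle (valP s') (valP s) (valP t').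
  have := delta_triangle (valP s) (valP t) (valP t').
  by rewrite [delta (val s') (val s)]deltaC; lra.
have := delta_triangle (valP s) (valP s') (valP t).
have := delta_triangle (valP s') (valP t') (valP t).
by rewrite [delta (val t') (val t)]deltaC; lra.
Qed.

(* The union of the geodesics from a to b; there is exactly one. *)
Definition tree_arc (a b : tree) : set tree :=
  [set c | exists2 g : R -> tree,
    [/\ g 0 = a, g (mdist a b) = b &
        {in `[0, mdist a b] &, forall x y, mdist (g x) (g y) = `|x - y|}] &
    (g @` `[0, mdist a b]) c].

Definition argmin01 : I01 :=
  xget zero01 [set t | forall s : I01, w (val t) <= w (val s)].

Lemma argmin01P (s : I01) : w (val argmin01) <= w (val s).
Proof.
by have := @xgetPex _ zero01 [set t | forall s : I01, w (val t) <= w (val s)]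
  cpath_argmin; exact.
Qed.

Definition tree_O : tree := tproj argmin01.
Definition tree_A : tree := tproj zero01.
Definition tree_B : tree := tproj one01.

Definition leaves : set tree :=
  [set a | forall b, b <> a -> ~ tree_arc tree_O b a].

Definition tree_borel : Type := g_sigma_algebraType (@open tree).

HB.instance Definition _ := Measurable.on tree_borel.

(* These two properties characterize a unique Borel measure on the tree. *)
Definition length_measure (lam : {measure set tree_borel -> \bar R}) : Prop :=
  lam leaves = 0%E /\
  forall a b : tree, lam (tree_arc a b) = (mdist a b)%:E.

Definition tfirst (a : tree) : R := inf (val @` (tproj @^-1` [set a])).
Definition tlast (a : tree) : R := sup (val @` (tproj @^-1` [set a])).

(* The two conditionals correspond to extending w monotonically on [-1, 0] and
   [1, 2] down to its minimum, and rho by 0. *)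
Definition Drho (rho : R -> R) (a : tree) : R :=
  (if a \in tree_arc tree_O tree_A then 0 else rho (tfirst a)) -
  (if a \in tree_arc tree_O tree_B then 0 else rho (tlast a)).

(* This is only meaningful when Drho rho is integrable. *)
Definition tree_integral (lam : {measure set tree_borel -> \bar R})
    (rho : R -> R) : R :=
  \int[lam]_(a in [set: tree_borel]) Drho rho a.

Definition tree_integral_on (lam : {measure set tree_borel -> \bar R})
    (s t : R) (rho : R -> R) : R :=
  tree_integral lam (fun x => rho x * \1_(`]s, t]) x).

End tree.

Arguments Drho {R} w rho a.

Section variation.
Context {R : realType}.

(* A subdivision 0 = t_0 < t_1 < ... < t_n = 1 is given by the sequence s of
   its points t_1, ..., t_n, following itv_partition. *)
Definition subdiv_pt (s : seq R) (i : nat) : R := nth 1 (0 :: s) i.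

Definition mesh (s : seq R) : R :=
  \big[Num.max/0]_(0 <= i < size s) (subdiv_pt s i.+1 - subdiv_pt s i).

Definition pvar (p : R) (f : R -> R) : \bar R :=
  ereal_sup [set (\sum_(0 <= i < size s)
                   `|f (subdiv_pt s i.+1) - f (subdiv_pt s i)| `^ p)%:E
            | s in itv_partition 0 1].

Definition var_index (f : R -> R) : \bar R :=
  ereal_inf [set p%:E | p in [set p | 1 <= p /\ (pvar p f < +oo)%E]].

Definition sup_norm (f : R -> R) : R := sup [set `|f t| | t in `[0, 1]].

Definition bounded_borel (f : R -> R) : Prop :=
  measurable_fun (`[0, 1] : set R) f /\ [bounded f t | t in `[0, 1]].

Definition young_bound (C p q : R) (w rho : R -> R) : \bar R :=
  (C%:E * pvar p w `^ p^-1 * (pvar q rho `^ q^-1 + (sup_norm rho)%:E))%E.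

(* In \bar R the inverse of +oo is 0. *)
Definition young_pair (w rho : R -> R) : Prop :=
  (1 < (var_index w)^-1 + (var_index rho)^-1)%E.

Definition RS_sum (w rho : R -> R) (s : seq R) (xi : nat -> R) : R :=
  \sum_(0 <= i < size s) rho (xi i) * (w (subdiv_pt s i.+1) - w (subdiv_pt s i)).

End variation.

(* Main.v *)
Require Import Defs.
From HB Require Import structures.
From mathcomp Require Import all_boot all_order all_algebra lra ring.
From mathcomp Require Import all_classical all_reals all_analysis measurable_realfun.
Import Order.TTheory GRing.Theory Num.Theory.
Import numFieldNormedType.Exports.
Local Open Scope classical_set_scope.
Local Open Scope ring_scope.

(* A point [a] of the tree is encoded by the time interval [[tfirst a, tlast a]];
   points incomparable for the ancestor order have disjoint intervals. If each
   point of such an antichain carries a subtree higher than [e], each interval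
   contributes at least [e ^ p] to the [p]-variation of [w], so there are at most
   [V_p(w) / e ^ p] of them, and Hoelder bounds the sum of [|Drho|] over the
   antichain by [(V_p(w) / e ^ p) ^ (1 - 1/q) * V_q(rho) ^ (1/q)].
   Points carrying a subtree of height between [e] and [2 e], at heights congruent
   modulo [e], form an antichain; as the length measure is Lebesgue measure along
   each branch, integrating over the residue in [(0, e]] bounds the contribution of
   this slice, and the bounds for [e = 2 ^ -k] form a geometric series which
   converges because [1/p + 1/q > 1].
   For [rho 1_(s, t]] the points of which exactly one extreme time is in [(s, t]]
   are those between [s] or [t] and their last common ancestor; this gives both the
   term in [sup |rho|] and the value [w t - w s] of the integral of [1_(s, t]]. So
   the estimate localizes to subintervals, and the Riemann sums converge as in
   Young's theorem. *)

Set Implicit Arguments.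
Unset Strict Implicit.
Unset Printing Implicit Defensive.

(** * Crossing times *)

Section crossing.
Context {R : realType}.
Implicit Types (f : R -> R) (r x y z u e : R).

(** The length measure is prescribed on arcs only, so sums over antichains do not turn into
    integrals at once. The points that are not leaves are covered by countably many pieces of
    branches ending at rational times, each of height [e], made disjoint. All pieces are
    parametrized by the same residue in [(0, e]]; for each residue the selected points form an
    antichain, so partial sums are bounded independently of the number of pieces. In the Riemann
    sums the local estimate is applied to [rho - rho xi], whose supremum on a small interval is
    controlled by its [q]-variation there. The resulting sum of products is bounded but not
    obviously small; raising [p] slightly while keeping [1/p + 1/q > 1] gains a power of the
    oscillation of [w], which tends to [0] with the mesh. *)

Definition cont01 f := forall x, 0 <= x <= 1 -> forall e, 0 < e ->
  exists2 d, 0 < d & forall y, 0 <= y <= 1 -> `|y - x| < d -> `|f y - f x| < e.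

Lemma within_cont01 f : {within `[0, 1], continuous f} -> cont01 f.
Proof.
move=> /subspace_continuousP cf x x01 e e0.
have /cf : `[0, 1]%classic x by rewrite /= in_itv.
move=> /cvgrPdist_lt /(_ _ e0); rewrite near_withinE => -[d /= d0 dP].
exists d => // y y01 yx; rewrite distrC; apply: dP => //=.
by rewrite distrC.
Qed.

Lemma cont01_rev f : cont01 f -> cont01 (fun x => f (1 - x)).
Proof.
move=> cf x x01 e e0; have [|d d0 dP] := cf (1 - x) _ e e0; first by lra.
exists d => // y y01 yx; apply: dP; first by lra.
by rewrite (_ : _ - _ = - (y - x)) ?normrN//; ring.
Qed.

(** The crossing time is the supremum of the times in [[r, x]] with [f <= y]. A mere intermediate
    value would not give [y <= f] on all of [[z, x]], which is what later makes [z] project to an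
    ancestor of the projection of [x]. *)
Lemma last_crossing f r x y : cont01 f -> 0 <= r -> r <= x -> x <= 1 ->
  f r <= y -> y <= f x ->
  exists2 z, r <= z <= x & f z = y /\ forall u, z <= u <= x -> y <= f u.
Proof.
move=> cf r0 rx x1 ry yx.
pose S := [set z | r <= z <= x /\ f z <= y].
have Sr : S r by rewrite /S /= lexx rx.
have ubS : ubound S x by move=> z [/andP[]].
have hS : has_sup S by split; [exists r|exists x].
have supx : sup S <= x by apply: ge_sup => //; exists r.
have rsup : r <= sup S by apply: ub_le_sup => //; exists x.
have s01 : 0 <= sup S <= 1 by lra.
have above u : sup S < u -> u <= x -> y < f u.
  move=> su ux; rewrite ltNge; apply/negP => fu.
  suff : u <= sup S by lra.
  by apply: ub_le_sup; [exists x|rewrite /S/=; split => //; lra].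
have fsy : f (sup S) = y.
  apply/eqP; rewrite eq_le; apply/andP; split; rewrite leNgt; apply/negP => h.
    have [|d d0 dP] := cf _ s01 (f (sup S) - y); first by lra.
    have [z [zx fz] zs] := sup_adherent d0 hS.
    have zs' : z <= sup S by apply: ub_le_sup; [exists x|split].
    have := dP z; rewrite ltr_norml ltr_norml.
    by move=> /(_ ltac:(lra) ltac:(lra)); lra.
  have sx : sup S < x.
    by rewrite lt_neqAle supx andbT; apply/eqP => sx; move: h; rewrite sx; lra.
  have [|d d0 dP] := cf _ s01 (y - f (sup S)); first by lra.
  pose u := Num.min x (sup S + d / 2).
  have u1 : sup S < u by rewrite lt_min sx/=; lra.
  have u2 : u <= x by rewrite ge_min lexx.
  have u3 : u <= sup S + d / 2 by rewrite ge_min lexx orbT.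
  have := above _ u1 u2; have := dP u; rewrite ltr_norml ltr_norml.
  by move=> /(_ ltac:(lra) ltac:(lra)); lra.
exists (sup S); first by rewrite rsup supx.
split => // u /andP[su ux].
move: su; rewrite le_eqVlt => /orP[/eqP <-|su]; first by rewrite fsy.
exact/ltW/above.
Qed.

Lemma first_crossing f r x y : cont01 f -> 0 <= x -> x <= r -> r <= 1 ->
  f r <= y -> y <= f x ->
  exists2 z, x <= z <= r & f z = y /\ forall u, x <= u <= z -> y <= f u.
Proof.
move=> cf x0 xr r1 ry yx.
have [|||||z zx [zy zP]] := @last_crossing _ (1 - r) (1 - x) y (cont01_rev cf).
- by lra.
- by lra.
- by lra.
- by rewrite subKr.
- by rewrite subKr.
exists (1 - z); first by lra.
split => // u uxz; rewrite -[u](subKr 1); apply: zP; lra.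
Qed.

End crossing.

(** * Ancestors *)

Section tree_order.
Context {R : realType} (w : cpath R).
Implicit Types (s t u x y : R) (a b : tree w).

Lemma cpath_cont01 : cont01 w.
Proof. exact: within_cont01 (@cpath_continuous _ w). Qed.

(** A disjunction of linear inequalities, usable by [lra], in place of the minimum and maximum in
    [path_min]. *)
Definition btw s t x := s <= x <= t \/ t <= x <= s.

Lemma btwC s t x : btw s t x <-> btw t s x.
Proof. by rewrite /btw; split=> -[]; tauto. Qed.

Lemma btwE s t x : btw s t x <-> Num.min s t <= x <= Num.max s t.
Proof.
rewrite /btw ge_min le_max; split.
  by move=> [/andP[-> ->]|/andP[-> ->]]; rewrite ?orbT.
case: (lerP s t) => st; first by move=> /andP[/orP[]? /orP[]?]; left; lra.
by move=> /andP[/orP[]? /orP[]?]; right; lra.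
Qed.

Lemma btw01 s t x : 0 <= s <= 1 -> 0 <= t <= 1 -> btw s t x -> 0 <= x <= 1.
Proof. by rewrite /btw => ? ? [] ?; lra. Qed.

Lemma btw_split s t u x : btw s u x -> btw s t x \/ btw t u x.
Proof. by rewrite /btw; case: (lerP x t) => ? [] ?; lra. Qed.

(** The ancestor order read on times, by [anc_tp]. *)
Definition path_ge s t := forall x, btw s t x -> w s <= w x.

Lemma argmin_btw s t : 0 <= s <= 1 -> 0 <= t <= 1 ->
  exists2 c, btw s t c & forall x, btw s t x -> w c <= w x.
Proof.
move=> s01 t01; have st : Num.min s t <= Num.max s t by rewrite ge_min !le_max lexx.
have [|c cst cP] := @EVT_min _ w _ _ st.
  apply: continuous_subspaceW (@cpath_continuous _ w) => x /=.
  by rewrite !in_itv/= => /btwE; apply: btw01.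
exists c => [|x /btwE xst]; first by apply/btwE; move: cst; rewrite in_itv.
by apply: cP; rewrite in_itv.
Qed.

Lemma path_minE s t c : 0 <= s <= 1 -> 0 <= t <= 1 -> btw s t c ->
  (forall x, btw s t x -> w c <= w x) -> path_min w s t = w c.
Proof.
move=> s01 t01 stc cP; apply/eqP; rewrite eq_le; apply/andP; split.
  by apply: path_min_le; rewrite ?in_itv//; exact/btwE.
by apply: Defs.le_path_min => x /btwE; exact: cP.
Qed.

Lemma btwL s t : btw s t s.
Proof. by rewrite /btw !lexx; case: (lerP s t) => h; [left|right]; rewrite //= ltW. Qed.

Lemma btwR s t : btw s t t.
Proof. by apply/btwC; exact: btwL. Qed.

Lemma path_geP s t : 0 <= s <= 1 -> 0 <= t <= 1 -> path_ge s t <-> path_min w s t = w s.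
Proof.
move=> s01 t01; split=> [st|st x xst]; first by apply: path_minE => //; exact: btwL.
by rewrite -st; apply: path_min_le; rewrite ?in_itv//; exact/btwE.
Qed.

(** Total version of [tproj], so that times remain plain reals; times outside [[0, 1]] are sent to
    the projection of [0]. *)
Definition tp t : tree w := tproj w (insubd (@zero01 R) t).

Lemma val_tp t : 0 <= t <= 1 -> val (insubd (@zero01 R) t) = t.
Proof. by move=> t01; rewrite insubdK// -topredE/= in_itv. Qed.

Lemma mdist_tp s t : 0 <= s <= 1 -> 0 <= t <= 1 -> mdist (tp s) (tp t) = delta w s t.
Proof. by move=> s01 t01; rewrite mdist_tproj !val_tp. Qed.

Lemma tproj_tp (t : @I01 R) : tproj w t = tp (val t).
Proof. by rewrite /tp valKd. Qed.

Lemma I01P (t : @I01 R) : 0 <= val t <= 1.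
Proof. by have := valP t; rewrite in_itv. Qed.

Lemma tp_surj a : exists2 t, 0 <= t <= 1 & tp t = a.
Proof.
exists (val (repr (a : {eq_quot delta_equiv w}%qT))); first exact: I01P.
by rewrite -tproj_tp /tproj reprK.
Qed.

Definition base_time : R := val (argmin01 w).

Lemma base01 : 0 <= base_time <= 1.
Proof. exact: I01P. Qed.

Lemma base_le t : 0 <= t <= 1 -> w base_time <= w t.
Proof. by move=> t01; have := argmin01P w (insubd (@zero01 R) t); rewrite val_tp. Qed.

Lemma tree_OE : tree_O w = tp base_time.
Proof. exact: tproj_tp. Qed.

Lemma tree_AE : tree_A w = tp 0.
Proof. exact: tproj_tp. Qed.

Lemma tree_BE : tree_B w = tp 1.
Proof. exact: tproj_tp. Qed.

Definition hgt a : R := mdist (tree_O w) a.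

Lemma hgt_tp t : 0 <= t <= 1 -> hgt (tp t) = w t - w base_time.
Proof.
move=> t01; rewrite /hgt tree_OE mdist_tp ?base01// /delta.
rewrite (path_minE (c := base_time)) ?base01//; first by ring.
  exact: btwL.
by move=> x xP; apply: base_le; exact: btw01 base01 t01 xP.
Qed.

Lemma hgt_ge0 a : 0 <= hgt a.
Proof. exact: mdist_ge0. Qed.

Lemma hgt_lip a b : `|hgt a - hgt b| <= mdist a b.
Proof.
have := metric_triangle (tree_O w) b a; have := metric_triangle (tree_O w) a b.
by rewrite -/(hgt a) -/(hgt b) (metric_sym b a) ler_norml; lra.
Qed.

(** As [hgt] is the distance to the root, this is equality in the triangle inequality through [a]:
    the point [a] lies on the geodesic from the root to [b]. The metric form avoids arcs until
    [tree_arcO]. *)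
Definition anc a b := mdist a b = hgt b - hgt a.

Lemma anc_tp s t : 0 <= s <= 1 -> 0 <= t <= 1 -> anc (tp s) (tp t) <-> path_ge s t.
Proof.
move=> s01 t01; rewrite path_geP// /anc mdist_tp// !hgt_tp// /delta.
by split => [|->]; lra.
Qed.

Lemma anc_refl a : anc a a.
Proof. by rewrite /anc mdistxx subrr. Qed.

Lemma anc_hgt a b : anc a b -> hgt a <= hgt b.
Proof. by rewrite /anc => ab; have := mdist_ge0 a b; lra. Qed.

Lemma anc_trans b a (c : tree w) : anc a b -> anc b c -> anc a c.
Proof.
rewrite /anc => ab bc; have := metric_triangle a b c.
by have := hgt_lip c a; rewrite ler_norml metric_sym; lra.
Qed.

Lemma anc_eq a b : anc a b -> hgt a = hgt b -> a = b.
Proof. by rewrite /anc => ab h; apply: mdist_positivity; rewrite ab h subrr. Qed.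

(** The interval between [s] and [t] is covered by those from [s] to [u] and from [u] to [t]; [w] is
    at least [w s] on the first and at least [w t >= w s] on the second. *)
Lemma anc_comparable (c : tree w) a b : anc a c -> anc b c -> hgt a <= hgt b -> anc a b.
Proof.
have [s s01 <-] := tp_surj a; have [t t01 <-] := tp_surj b.
have [u u01 <-] := tp_surj c; rewrite !anc_tp// !hgt_tp// => su tu h x xst.
have [xs|xt] := btw_split u xst; first exact: su.
by apply: (@le_trans _ _ (w t)); [lra|apply: tu; exact/btwC].
Qed.

(** The ancestor is the projection of the crossing of the level closest to [t], between [base_time]
    and [t]. *)
Lemma anc_level b y : 0 <= y <= hgt b -> exists2 a, anc a b & hgt a = y.
Proof.
have [t t01 <-] := tp_surj b; rewrite hgt_tp// => yt.
suff [s s01 [sy st]] : exists2 s, 0 <= s <= 1 & w s = w base_time + y /\ path_ge s t.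
  by exists (tp s); [exact/anc_tp|rewrite hgt_tp// sy; ring].
have := base01 => b01; have [h|h] := leP base_time t.
  have [|||||s st [sy sP]] := @last_crossing _ w base_time t (w base_time + y) cpath_cont01.
  - by lra. - by lra. - by lra. - by lra. - by lra.
  by exists s; [lra|split=> // x [] ?; rewrite sy; apply: sP; lra].
have [|||||s st [sy sP]] := @first_crossing _ w base_time t (w base_time + y) cpath_cont01.
- by lra. - by lra. - by lra. - by lra. - by lra.
by exists s; [lra|split=> // x [] ?; rewrite sy; apply: sP; lra].
Qed.

(** The last common ancestor is visited when [w] is minimal between [s] and [t]. If [r] is a time of
    a common ancestor, [c] lies between [r] and one of [s], [t], whence [w r <= w c]. *)
Lemma anc_meet s t : 0 <= s <= 1 -> 0 <= t <= 1 ->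
  exists2 c, 0 <= c <= 1 /\ path_min w s t = w c &
    forall a, (anc a (tp s) /\ anc a (tp t)) <-> anc a (tp c).
Proof.
move=> s01 t01; have [c cst cP] := argmin_btw s01 t01.
have c01 := btw01 s01 t01 cst.
exists c => [|a]; first by split => //; exact: path_minE.
have cs : anc (tp c) (tp s).
  by apply/anc_tp => // x cx; apply: cP; move: cst cx; rewrite /btw; lra.
have ct : anc (tp c) (tp t).
  by apply/anc_tp => // x cx; apply: cP; move: cst cx; rewrite /btw; lra.
split => [[a_s a_t]|ac]; last by split; exact: anc_trans ac _.
apply: (anc_comparable a_s cs).
have [r r01 ra] := tp_surj a; move: a_s a_t; rewrite -ra => /anc_tp rs /anc_tp rt.
rewrite !hgt_tp// lerD2r.
have [] := @btw_split s r t c cst.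
  by move/btwC; exact: rs.
by exact: rt.
Qed.

(* The point at height [y] on the branch from the root to [b], with [y] clamped
   to [[0, hgt b]]. *)
Definition branch b y : tree w :=
  xget (tree_O w) [set a | anc a b /\ hgt a = Num.max 0 (Num.min y (hgt b))].

Lemma branchP b y :
  anc (branch b y) b /\ hgt (branch b y) = Num.max 0 (Num.min y (hgt b)).
Proof.
have [|a ab ay] := @anc_level b (Num.max 0 (Num.min y (hgt b))).
  by rewrite le_max lexx/= ge_max hgt_ge0 ge_min lexx orbT.
exact: (@xgetPex _ (tree_O w) [set a | anc a b /\
  hgt a = Num.max 0 (Num.min y (hgt b))] (ex_intro _ a (conj ab ay))).
Qed.

Lemma branch_anc b y : anc (branch b y) b.
Proof. by have [] := branchP b y. Qed.

Lemma hgt_branch b y : 0 <= y <= hgt b -> hgt (branch b y) = y.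
Proof.
by move=> /andP[y0 yb]; have [_ ->] := branchP b y; rewrite (min_idPl yb) (max_idPr y0).
Qed.

Lemma branch_hgt a b : anc a b -> branch b (hgt a) = a.
Proof.
move=> ab; have [h0 h] := (hgt_ge0 a, anc_hgt ab).
have ah : hgt (branch b (hgt a)) = hgt a by rewrite hgt_branch ?h0.
apply: anc_eq => //; apply: (anc_comparable (branch_anc _ _) ab).
by rewrite ah.
Qed.

Lemma branch_dist b x y :
  mdist (branch b x) (branch b y) = `|hgt (branch b x) - hgt (branch b y)|.
Proof.
wlog xy : x y / hgt (branch b x) <= hgt (branch b y).
  move=> H; have [|/ltW] := leP (hgt (branch b x)) (hgt (branch b y)); first exact: H.
  by rewrite metric_sym distrC; exact: H.
rewrite (anc_comparable (branch_anc b x) (branch_anc b y) xy) distrC ger0_norm//.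
by rewrite subr_ge0.
Qed.

Lemma branch_lip b x y : mdist (branch b x) (branch b y) <= `|x - y|.
Proof.
have [[_ hx] [_ hy]] := (branchP b x, branchP b y).
rewrite branch_dist hx hy; have := hgt_ge0 b; set h := hgt b => h0.
have xy := ler_norm (x - y); have yx := ler_norm (- (x - y)).
move: xy yx; rewrite normrN; move: `|x - y| => N xy yx.
rewrite ler_norml /Num.max /Num.min.
by case: (ltP x h) => ?; case: (ltP y h) => ?; do ![case: (ltP 0) => ?]; lra.
Qed.

(** Along any geodesic [g] issued from the root [hgt (g x) = x], which yields the equation defining
    [anc]; conversely [branch b] is such a geodesic. *)
Lemma tree_arcO a b : tree_arc (tree_O w) b a <-> anc a b.
Proof.
split=> [[g [g0 gb gP] [x xb <-]]|ab].
  have d0 : 0 <= mdist (tree_O w) b by exact: mdist_ge0.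
  move: xb; rewrite /= in_itv /= => xb.
  have hx : hgt (g x) = x.
    rewrite /hgt -{1}g0 gP ?in_itv/= ?lexx ?d0//.
    by rewrite sub0r normrN ger0_norm; lra.
  rewrite /anc hx -{1}gb gP ?in_itv/= ?lexx ?d0//.
  by rewrite distrC ger0_norm -/(hgt b); [|move: xb; rewrite -/(hgt b); lra].
exists (branch b); last first.
  by exists (hgt a); rewrite ?branch_hgt//= in_itv/= hgt_ge0/= anc_hgt.
split=> [||x y].
- have h : hgt (branch b 0) = 0 by rewrite hgt_branch// lexx hgt_ge0.
  by apply/esym/mdist_positivity; exact: h.
- by rewrite -/(hgt b) branch_hgt//; exact: anc_refl.
- by rewrite !in_itv/= -/(hgt b) => xb yb; rewrite branch_dist !hgt_branch.
Qed.

End tree_order.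

(** * First and last visit times of a point *)

Section extreme_times.
Context {R : realType} (w : cpath R).
Implicit Types (s t u x y : R) (a b : tree w).

Let times a : set R := val @` (tproj w @^-1` [set a]).

Lemma timesP a t : times a t <-> 0 <= t <= 1 /\ tp w t = a.
Proof.
split=> [[u /= ua <-]|[t01 ta]].
  by split; [exact: I01P|rewrite -tproj_tp].
exists (insubd (@zero01 R) t); last exact: val_tp.
by rewrite /= -ta.
Qed.

Lemma tp_eq s t : 0 <= s <= 1 -> 0 <= t <= 1 -> path_ge w s t -> w s = w t -> tp w s = tp w t.
Proof. by move=> s01 t01 /anc_tp st wst; apply: anc_eq; [exact: st|rewrite !hgt_tp// wst]. Qed.

Lemma tp_eq_val s t : 0 <= s <= 1 -> 0 <= t <= 1 -> tp w s = tp w t -> w s = w t.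
Proof. by move=> s01 t01 st; have := hgt_tp w s01; rewrite st hgt_tp// => /addIr. Qed.

Lemma tp_eq_path_ge s t : 0 <= s <= 1 -> 0 <= t <= 1 -> tp w s = tp w t -> path_ge w s t.
Proof. by move=> s01 t01 st; apply/anc_tp => //; rewrite st; exact: anc_refl. Qed.

Let times_has_inf a : has_inf (times a).
Proof.
have [t t01 ta] := tp_surj a.
by split; [exists t; exact/timesP|exists 0 => x /timesP[]; lra].
Qed.

Let times_has_sup a : has_sup (times a).
Proof.
have [t t01 ta] := tp_surj a.
by split; [exists t; exact/timesP|exists 1 => x /timesP[]; lra].
Qed.

Lemma tfirst_le a t : 0 <= t <= 1 -> tp w t = a -> tfirst a <= t.
Proof. by move=> t01 ta; apply: ge_inf; [case: (times_has_inf a)|exact/timesP]. Qed.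

Lemma tlast_ge a t : 0 <= t <= 1 -> tp w t = a -> t <= tlast a.
Proof. by move=> t01 ta; apply: ub_le_sup; [case: (times_has_sup a)|exact/timesP]. Qed.

Lemma tfirst_le_tlast a : tfirst a <= tlast a.
Proof.
by have [t t01 ta] := tp_surj a; exact: le_trans (tfirst_le t01 ta) (tlast_ge t01 ta).
Qed.

Lemma tfirst_ge0 a : 0 <= tfirst a.
Proof. by apply: lb_le_inf; [case: (times_has_inf a)|move=> x /timesP[]; lra]. Qed.

Lemma tlast_le1 a : tlast a <= 1.
Proof. by apply: ge_sup; [case: (times_has_sup a)|move=> x /timesP[]; lra]. Qed.

Lemma tfirst01 a : 0 <= tfirst a <= 1.
Proof. by rewrite tfirst_ge0/= (le_trans (tfirst_le_tlast a))// tlast_le1. Qed.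

Lemma tlast01 a : 0 <= tlast a <= 1.
Proof. by rewrite tlast_le1 andbT (le_trans (tfirst_ge0 a))// tfirst_le_tlast. Qed.

Let cluster_value_eq f c : 0 <= f <= 1 ->
  (forall d, 0 < d -> exists2 s, 0 <= s <= 1 & `|s - f| < d /\ w s = c) -> w f = c.
Proof.
move=> f01 fP; apply/eqP; apply/negPn/negP => fc.
have e0 : 0 < `|w f - c| by rewrite normr_gt0 subr_eq0.
have [d d0 dP] := cpath_cont01 w f01 e0.
by have [s s01 [sf sc]] := fP _ d0; have := dP _ s01 sf; rewrite sc distrC ltxx.
Qed.

(** The infimum is attained: by continuity [w] takes there the same value as at the times of [a],
    and any later [x] up to [t] is preceded by a time [s] of [a], with [w >= w s] on [[s, t]]. *)
Lemma tp_tfirst a : tp w (tfirst a) = a.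
Proof.
have [t t01 ta] := tp_surj a; have ft := tfirst_le t01 ta; have f01 := tfirst01 a.
have near_f d : 0 < d -> exists2 s, 0 <= s <= 1 & tfirst a <= s < tfirst a + d /\ tp w s = a.
  move=> d0; have [s /timesP[s01 sa] sd] := inf_adherent d0 (times_has_inf a).
  by exists s => //; split => //; rewrite (tfirst_le s01 sa).
have wf : w (tfirst a) = w t.
  apply: cluster_value_eq => // d d0; have [s s01 [sf sa]] := near_f _ d0.
  exists s => //; split; first by rewrite ger0_norm; lra.
  by apply: tp_eq_val; rewrite // sa.
rewrite -[RHS]ta; apply: tp_eq => // x []; last by move=> ?; rewrite wf (_ : x = t); lra.
move=> /andP[fx xt]; rewrite wf.
have [->|xf] := eqVneq x (tfirst a); first by rewrite wf.
have [|s s01 [sf sa]] := near_f (x - tfirst a).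
  by rewrite subr_gt0 lt_neqAle eq_sym xf fx.
by rewrite -(@tp_eq_val s t)// ?sa//; apply: (@tp_eq_path_ge s t); rewrite ?sa//; left; lra.
Qed.

Lemma tp_tlast a : tp w (tlast a) = a.
Proof.
have [t t01 ta] := tp_surj a; have tl := tlast_ge t01 ta; have l01 := tlast01 a.
have near_l d : 0 < d -> exists2 s, 0 <= s <= 1 & tlast a - d < s <= tlast a /\ tp w s = a.
  move=> d0; have [s /timesP[s01 sa] sd] := sup_adherent d0 (times_has_sup a).
  by exists s => //; split => //; rewrite (tlast_ge s01 sa) andbT.
have wl : w (tlast a) = w t.
  apply: cluster_value_eq => // d d0; have [s s01 [sl sa]] := near_l _ d0.
  exists s => //; split; first by rewrite distrC ger0_norm; lra.
  by apply: tp_eq_val; rewrite // sa.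
rewrite -[RHS]ta; apply: tp_eq => // x []; first by move=> ?; rewrite wl (_ : x = t); lra.
move=> /andP[tx xl]; rewrite wl.
have [->|xf] := eqVneq x (tlast a); first by rewrite wl.
have [|s s01 [sl sa]] := near_l (tlast a - x).
  by rewrite subr_gt0 lt_neqAle xf xl.
by rewrite -(@tp_eq_val s t)// ?sa//; apply: (@tp_eq_path_ge s t); rewrite ?sa//; right; lra.
Qed.

Lemma anc_path_ge f a x : 0 <= f <= 1 -> tp w f = a -> 0 <= x <= 1 ->
  anc a (tp w x) <-> path_ge w f x.
Proof. by move=> f01 <- x01; exact: anc_tp. Qed.

Lemma anc_tfirst a x : 0 <= x <= 1 -> anc a (tp w x) <-> path_ge w (tfirst a) x.
Proof. by apply: anc_path_ge; [exact: tfirst01|exact: tp_tfirst]. Qed.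

Lemma anc_tlast a x : 0 <= x <= 1 -> anc a (tp w x) <-> path_ge w (tlast a) x.
Proof. by apply: anc_path_ge; [exact: tlast01|exact: tp_tlast]. Qed.

Lemma anc_between a x : tfirst a <= x <= tlast a -> anc a (tp w x).
Proof.
move=> fxl; have f01 := tfirst01 a; have l01 := tlast01 a.
apply/anc_tfirst; first by lra.
move=> y fxy; have : path_ge w (tfirst a) (tlast a).
  by apply: tp_eq_path_ge; rewrite // tp_tfirst tp_tlast.
by apply; left; move: fxy; rewrite /btw; lra.
Qed.

(** Otherwise [w] goes below the level of [a] at some [r < x], and the last crossing of this level
    before [x] is a time of [a] earlier than [tfirst a]. So, off [[O, A]], no descendant of [a] is
    visited before [tfirst a]. *)
Lemma anc_before a x : 0 <= x <= 1 -> anc a (tp w x) -> x < tfirst a -> anc a (tree_A w).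
Proof.
move=> x01 ax xf; have f01 := tfirst01 a; have o01 : 0 <= (0:R) <= 1 by lra.
rewrite tree_AE; apply/anc_tfirst => // r rf.
rewrite leNgt; apply/negP => wr.
have /anc_tfirst fx := ax; have {}fx := fx x01.
have rx : r < x.
  rewrite ltNge; apply/negP => xr; have : w (tfirst a) <= w r.
    by apply: fx; right; move: rf; rewrite /btw; lra.
  by lra.
have r0 : 0 <= r by move: rf; rewrite /btw; lra.
have wx : w (tfirst a) <= w x by apply: fx; exact: btwR.
have [|||||z zx [wz zP]] := @last_crossing _ w r x (w (tfirst a)) (@cpath_cont01 _ w).
- by lra. - by lra. - by lra. - by lra. - by lra.
have zf : tp w z = a.
  rewrite -[RHS]tp_tfirst; apply: tp_eq; [lra|lra| |by []] => y yz; rewrite wz.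
  by have [yx|xy] := leP y x; [apply: zP|apply: fx; right]; move: yz; rewrite /btw; lra.
have := tfirst_le _ zf; lra.
Qed.

Lemma anc_after a x : 0 <= x <= 1 -> anc a (tp w x) -> tlast a < x -> anc a (tree_B w).
Proof.
move=> x01 ax xf; have f01 := tlast01 a; have o01 : 0 <= (1:R) <= 1 by lra.
rewrite tree_BE; apply/anc_tlast => // r rf.
rewrite leNgt; apply/negP => wr.
have /anc_tlast fx := ax; have {}fx := fx x01.
have rx : x < r.
  rewrite ltNge; apply/negP => xr; have : w (tlast a) <= w r.
    by apply: fx; left; move: rf; rewrite /btw; lra.
  by lra.
have r1 : r <= 1 by move: rf; rewrite /btw; lra.
have wx : w (tlast a) <= w x by apply: fx; exact: btwR.
have [|||||z zx [wz zP]] := @first_crossing _ w r x (w (tlast a)) (@cpath_cont01 _ w).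
- by lra. - by lra. - by lra. - by lra. - by lra.
have zf : tp w z = a.
  rewrite -[RHS]tp_tlast; apply: tp_eq; [lra|lra| |by []] => y yz; rewrite wz.
  by have [yx|xy] := leP x y; [apply: zP|apply: fx; left]; move: yz; rewrite /btw; lra.
have := tlast_ge _ zf; lra.
Qed.

Lemma anc_overlap a b x : tfirst a <= x <= tlast a -> tfirst b <= x <= tlast b ->
  anc a b \/ anc b a.
Proof.
move=> /anc_between ax /anc_between bx.
by have [ab|/ltW ba] := leP (hgt a) (hgt b);
  [left; exact: anc_comparable ax bx ab|right; exact: anc_comparable bx ax ba].
Qed.

(** [actL] says that the term of [Drho] at [tfirst a], for [rho 1_(s, t]], is cancelled neither by
    the convention on [[O, A]] nor by the indicator; [actR] says the same of the term at
    [tlast a]. *)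
Definition actL s t a := ~ anc a (tree_A w) /\ s < tfirst a <= t.
Definition actR s t a := ~ anc a (tree_B w) /\ s < tlast a <= t.

Lemma Drho_indic (rho : R -> R) s t a : Drho w (fun x => rho x * \1_(`]s, t]) x) a =
  (if `[<actL s t a>] then rho (tfirst a) else 0) -
  (if `[<actR s t a>] then rho (tlast a) else 0).
Proof.
rewrite /Drho !indicE /=; congr (_ - _).
  case: ifPn => [/set_mem /tree_arcO aA|/negP aA]; case: asboolP => //.
  - by move=> [].
  - by move=> [_ fst]; rewrite mem_set ?mulr1//= in_itv.
  - move=> nL; rewrite memNset ?mulr0//= in_itv/= => fst; apply: nL; split => //.
    by move/tree_arcO => h; apply: aA; exact: mem_set.
case: ifPn => [/set_mem /tree_arcO aA|/negP aA]; case: asboolP => //.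
- by move=> [].
- by move=> [_ fst]; rewrite mem_set ?mulr1//= in_itv.
- move=> nL; rewrite memNset ?mulr0//= in_itv/= => fst; apply: nL; split => //.
  by move/tree_arcO => h; apply: aA; exact: mem_set.
Qed.

(** Passing to []0, 1]] loses only the time [0], which is a time of [tree_A] alone; a single point
    is negligible for the length measure. *)
Lemma Drho_indic01 (rho : R -> R) a : a <> tree_A w ->
  Drho w rho a = Drho w (fun x => rho x * \1_(`]0, 1]) x) a.
Proof.
move=> aA; suff in_ioc x : 0 <= x <= 1 -> tp w x = a -> x \in [set` `]0, 1]].
  rewrite /Drho !indicE (in_ioc (tfirst a)) ?tfirst01 ?tp_tfirst//.
  by rewrite (in_ioc (tlast a)) ?tlast01 ?tp_tlast// !mulr1.
move=> /andP[x0 x1] xa; rewrite mem_set//= in_itv/= x1 andbT lt_neqAle x0 andbT eq_sym.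
by apply/eqP => x_0; apply: aA; rewrite tree_AE -xa x_0.
Qed.

End extreme_times.

(** * Variation over families of intervals *)

Section variation_families.
Context {R : realType}.
Implicit Types (f : R -> R) (p s t u M : R) (l : seq (R * R)).

(** Gaps and degenerate intervals are allowed, unlike in [itv_partition], so that disjoint families
    and concatenations need no refinement. *)
Fixpoint intervals s t l : bool :=
  if l is x :: l' then [&& s <= x.1, x.1 <= x.2 & intervals x.2 t l'] else s <= t.

Definition power_sum p f l : R := \sum_(x <- l) `|f x.2 - f x.1| `^ p.

(** A bound in place of a supremum passes to subintervals and larger constants without any question
    of finiteness. *)
Definition var_le p f s t M := forall l, intervals s t l -> power_sum p f l <= M.

Lemma intervals_le s t l : intervals s t l -> s <= t.
Proof.
elim: l s => //= x l ih s /and3P[sx xx /ih xt].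
exact: le_trans sx (le_trans xx xt).
Qed.

Lemma intervals_cat s t u l l' :
  intervals s t l -> intervals t u l' -> intervals s u (l ++ l').
Proof.
elim: l s => [s /= st|x l ih s /= /and3P[-> -> /ih h] /h ->//].
case: l' => [|y l' /=]; first exact: le_trans st.
by move=> /and3P[ty -> ->]; rewrite (le_trans st ty).
Qed.

Lemma intervals_widen s' t' s t l : s' <= s -> t <= t' -> intervals s t l -> intervals s' t' l.
Proof.
elim: l s' s => [s' s ss tt /= st|x l ih s' s ss tt /= /and3P[sx -> h]].
  exact: le_trans ss (le_trans st tt).
by rewrite (le_trans ss sx)/=; exact: ih h.
Qed.

Lemma power_sum_cat p f l l' : power_sum p f (l ++ l') = power_sum p f l + power_sum p f l'.
Proof. by rewrite /power_sum big_cat. Qed.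

Lemma var_le_ge0 p f s t M : s <= t -> var_le p f s t M -> 0 <= M.
Proof. by move=> st /(_ [::] st); rewrite /power_sum big_nil. Qed.

Lemma var_le_sub s' t' p f s t M : s' <= s -> t <= t' -> var_le p f s' t' M -> var_le p f s t M.
Proof. by move=> ss tt h l /(intervals_widen ss tt)/h. Qed.

Lemma var_le_W p f s t M M' : M <= M' -> var_le p f s t M -> var_le p f s t M'.
Proof. by move=> MM h l /h /le_trans; exact. Qed.

Lemma var_le_osc p f s t M x y : var_le p f s t M -> s <= x <= t -> s <= y <= t ->
  `|f y - f x| `^ p <= M.
Proof.
move=> h sx sy; wlog xy : x y sx sy / x <= y.
  by move=> H; case: (leP x y) => [|/ltW] /H; [exact|rewrite distrC; exact].
have := h [:: (x, y)]; rewrite /power_sum big_seq1/=; apply.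
by apply/and3P; split; lra.
Qed.

Lemma intervals_sort (T : eqType) (r : seq T) (I : T -> R * R) s t : s <= t ->
  uniq r -> {in r, forall a, s <= (I a).1 /\ (I a).1 <= (I a).2 <= t} ->
  {in r &, forall a b, a != b -> (I a).2 < (I b).1 \/ (I b).2 < (I a).1} ->
  sorted (relpre (fst \o I) <=%O) r -> intervals s t (map I r).
Proof.
elim: r s => //= x r ih s st /andP[xr ur] rst dis; rewrite path_sortedE; last first.
  by move=> a b c; exact: le_trans.
move=> /andP[/allP xle sr].
have [sx /andP[xx xt]] : s <= (I x).1 /\ (I x).1 <= (I x).2 <= t.
  by apply: rst; rewrite inE eqxx.
rewrite sx xx/=; apply: ih => //; last first.
  by move=> a b ar br; apply: dis; rewrite inE (ar, br) orbT.
move=> a ar; have [sa aat] : s <= (I a).1 /\ (I a).1 <= (I a).2 <= t.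
  by apply: rst; rewrite inE ar orbT.
have xa : x != a by apply: contraNneq xr => ->.
have := xle a ar; rewrite /= => xa1; split => //.
have [] := dis x a _ _ xa; rewrite ?inE ?eqxx ?ar ?orbT//.
  by move/ltW.
lra.
Qed.

(** Sorting by left endpoints turns the disjoint intervals into a chain. *)
Lemma var_le_family p f s t M (T : eqType) (r : seq T) (I : T -> R * R) : s <= t ->
  var_le p f s t M -> uniq r ->
  {in r, forall a, s <= (I a).1 /\ (I a).1 <= (I a).2 <= t} ->
  {in r &, forall a b, a != b -> (I a).2 < (I b).1 \/ (I b).2 < (I a).1} ->
  \sum_(a <- r) `|f (I a).2 - f (I a).1| `^ p <= M.
Proof.
move=> st fM ur rst dis; pose r' := sort (relpre (fst \o I) <=%O) r.
have rr' : perm_eq r r' by rewrite perm_sym perm_sort.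
rewrite (perm_big r' rr') /= -(big_map I predT (fun x => `|f x.2 - f x.1| `^ p)).
apply: fM; apply: intervals_sort => //.
- by rewrite sort_uniq.
- by move=> a; rewrite mem_sort; exact: rst.
- by move=> a b; rewrite !mem_sort; exact: dis.
- by apply: sort_sorted => a b; exact: le_total.
Qed.

(* A junk value when the variation is infinite. *)
Definition variation_on p f s t : R := sup [set power_sum p f l | l in intervals s t].

Lemma variation_onP p f s t M : s <= t -> var_le p f s t M ->
  var_le p f s t (variation_on p f s t).
Proof.
move=> st fM l sl; apply: ub_le_sup; last by exists l.
by exists M => _ [l' sl' <-]; exact: fM.
Qed.

Lemma variation_on_le p f s t M : s <= t -> var_le p f s t M -> variation_on p f s t <= M.
Proof.
move=> st fM; apply: ge_sup; first by exists (power_sum p f [::]), [::].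
by move=> _ [l sl <-]; exact: fM.
Qed.

Lemma variation_on_ge0 p f s t M : s <= t -> var_le p f s t M -> 0 <= variation_on p f s t.
Proof. by move=> st fM; exact: var_le_ge0 st (variation_onP st fM). Qed.

(** Chains over [[s, t]] and [[t, u]] concatenate. Superadditivity is what allows local estimates to
    be summed over a subdivision. *)
Lemma variation_on_superadd p f s t u M : s <= t -> t <= u -> var_le p f s u M ->
  variation_on p f s t + variation_on p f t u <= variation_on p f s u.
Proof.
move=> st tu fM; have fM1 := var_le_sub (lexx s) tu fM.
have fM2 := var_le_sub st (lexx u) fM.
have := variation_onP (le_trans st tu) fM; move: (variation_on p f s u) => V fV.
rewrite -lerBrDr; apply: variation_on_le => // l sl; rewrite lerBrDr addrC -lerBrDr.
apply: variation_on_le => // l' tl; rewrite lerBrDr addrC -power_sum_cat.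
by apply: fV; exact: intervals_cat sl tl.
Qed.

End variation_families.

(** * Points with an extreme time in [(s, t]], and antichains of such points *)

Section activity.
Context {R : realType} (w : cpath R).
Implicit Types (s t u x y : R) (a b : tree w).

Section fixed_interval.
Variables (s t : R).
Hypotheses (s0 : 0 <= s) (st : s <= t) (t1 : t <= 1).

Let s01 : 0 <= s <= 1. Proof. by rewrite s0 (le_trans st). Qed.
Let t01 : 0 <= t <= 1. Proof. by rewrite t1 (le_trans s0). Qed.
Let o01 : 0 <= (0:R) <= 1. Proof. by rewrite lexx ler01. Qed.
Let i01 : 0 <= (1:R) <= 1. Proof. by rewrite lexx ler01. Qed.

(** Either [t <= tlast a], and [t] lies between the extreme times of [a]; or [tlast a] is in
    [(s, t]] and is disregarded only because [a] is on [[O, B]], in which case [w] stays above the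
    level of [a] from [tlast a] to [1]. *)
Lemma actL_only a : actL s t a -> ~ actR s t a -> anc a (tp w t) /\ ~ anc a (tp w s).
Proof.
move=> [nA /andP[sf ft]] nR; split; last by move=> h; apply: nA; exact: anc_before h sf.
have [tl|lt] := leP t (tlast a); first by apply: anc_between; rewrite ft.
have sl : s < tlast a <= t by rewrite (lt_le_trans sf (tfirst_le_tlast a)) ltW.
have /contrapT aB : ~ ~ anc a (tree_B w) by move=> nB; apply: nR.
apply/anc_tlast => // x lx; move: aB; rewrite tree_BE => /anc_tlast; apply => //.
by left; move: lx s0 st t1; rewrite /btw; lra.
Qed.

(** The half-open interval breaks the symmetry with [actL_only]: if [tlast a = t], the right term
    counts although [a] is an ancestor of [tp w t]. Hence the excluded point. *)
Lemma actR_only a : actR s t a -> ~ actL s t a -> a <> tp w t ->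
  anc a (tp w s) /\ ~ anc a (tp w t).
Proof.
move=> [nB /andP[sl lt]] nL at_; split; last first.
  move=> h; apply: nB; apply: (anc_after _ h) => //.
  by rewrite lt_neqAle lt andbT; apply/eqP => lt'; apply: at_; rewrite -lt' tp_tlast.
have [fs|sf] := leP (tfirst a) s; first by apply: anc_between; rewrite fs ltW.
have sft : s < tfirst a <= t by rewrite sf (le_trans (tfirst_le_tlast a)).
have /contrapT aA : ~ ~ anc a (tree_A w) by move=> nA; apply: nL.
apply/anc_tlast => // x lx; move: aA; rewrite tree_AE => /anc_tlast; apply => //.
by right; move: lx s0 st t1; rewrite /btw; lra.
Qed.

Lemma anc_right_only a : a <> tp w t -> anc a (tp w t) -> ~ anc a (tp w s) ->
  actL s t a /\ ~ actR s t a.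
Proof.
move=> at_ hat nas; have f01 := tfirst01 a; have l01 := tlast01 a.
have /anc_tfirst ft := hat; have {}ft := ft t01.
have sf : s < tfirst a.
  rewrite ltNge; apply/negP => fs; apply: nas; apply/anc_tfirst => // x fx.
  by apply: ft; left; move: fx s0 st t1; rewrite /btw; lra.
have nA : ~ anc a (tree_A w).
  rewrite tree_AE => /anc_tfirst => /(_ o01) f0; apply: nas; apply/anc_tfirst => // x fx.
  by apply: f0; right; move: fx s0 st t1; rewrite /btw; lra.
split.
  split => //; rewrite sf/= leNgt; apply/negP => tf; apply: nA.
  exact: anc_before hat tf.
move=> [nB /andP[sl lt]]; apply: nB; apply: (anc_after _ hat) => //.
by rewrite lt_neqAle lt andbT; apply/eqP => lt'; apply: at_; rewrite -lt' tp_tlast.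
Qed.

Lemma anc_left_only a : a <> tp w s -> anc a (tp w s) -> ~ anc a (tp w t) ->
  ~ actL s t a /\ actR s t a.
Proof.
move=> as_ has nat_; have f01 := tfirst01 a; have l01 := tlast01 a.
have /anc_tlast ls := has; have {}ls := ls s01.
have lt : tlast a < t.
  rewrite ltNge; apply/negP => tl; apply: nat_; apply/anc_tlast => // x lx.
  by apply: ls; right; move: lx s0 st t1; rewrite /btw; lra.
have nB : ~ anc a (tree_B w).
  rewrite tree_BE => /anc_tlast => /(_ i01) l1; apply: nat_; apply/anc_tlast => // x fx.
  by apply: l1; left; move: fx s0 st t1; rewrite /btw; lra.
split.
  move=> [nA /andP[sf ft]]; apply: nA; exact: anc_before has sf.
split => //; rewrite ltW// andbT ltNge; apply/negP => ls'; apply: nB.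
apply: (anc_after _ has) => //.
by rewrite lt_neqAle ls' andbT; apply/eqP => h; apply: as_; rewrite -h tp_tlast.
Qed.

(** Off two negligible points, [Drho] of [1_(s, t]] is a difference of indicators of two branches,
    whose integral is the difference of their lengths. *)
Lemma act_indic a : a <> tp w s -> a <> tp w t ->
  (`[<actL s t a>]%:R - `[<actR s t a>]%:R : R) =
  `[<anc a (tp w t)>]%:R - `[<anc a (tp w s)>]%:R.
Proof.
move=> as_ at_.
have [hat|nat_] := pselect (anc a (tp w t)); have [has|nas] := pselect (anc a (tp w s)).
- rewrite (asboolT hat) (asboolT has) subrr.
  have [L|nL] := pselect (actL s t a); have [Rr|nR] := pselect (actR s t a).
  + by rewrite (asboolT L) (asboolT Rr) subrr.
  + by have [] := actL_only L nR.
  + by have [] := actR_only Rr nL at_.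
  + by rewrite (asboolF nL) (asboolF nR) subrr.
- have [L nR] := anc_right_only at_ hat nas.
  by rewrite (asboolT L) (asboolF nR) (asboolT hat) (asboolF nas).
- have [nL Rr] := anc_left_only as_ has nat_.
  by rewrite (asboolF nL) (asboolT Rr) (asboolF nat_) (asboolT has).
- rewrite (asboolF nat_) (asboolF nas) subrr.
  have [L|nL] := pselect (actL s t a); have [Rr|nR] := pselect (actR s t a).
  + by rewrite (asboolT L) (asboolT Rr) subrr.
  + by have [] := actL_only L nR.
  + by have [] := actR_only Rr nL at_.
  + by rewrite (asboolF nL) (asboolF nR) subrr.
Qed.

(** When neither convention applies, all descendants are visited between the extreme times; in
    particular the high descendant provided by [tall] is. *)
Lemma act_both_witness a x : actL s t a -> actR s t a -> 0 <= x <= 1 ->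
  anc a (tp w x) -> tfirst a <= x <= tlast a.
Proof.
move=> [nA _] [nB _] x01 ax; rewrite !leNgt; apply/andP; split; apply/negP => h.
  by apply: nA; exact: anc_before ax h.
by apply: nB; exact: anc_after ax h.
Qed.

End fixed_interval.

(* The points carrying a subtree of height greater than [e]. *)
Definition tall e : set (tree w) :=
  [set a | exists2 x, 0 <= x <= 1 & anc a (tp w x) /\ hgt a + e < hgt (tp w x)].

Lemma tall_anc e a b : anc a b -> tall e b -> tall (e + (hgt b - hgt a)) a.
Proof.
move=> ab [x x01 [bx h]]; exists x => //; split; first exact: anc_trans ab bx.
by lra.
Qed.

Lemma tall_le e e' a : e <= e' -> tall e' a -> tall e a.
Proof. by move=> ee [x x01 [ax h]]; exists x => //; split => //; lra. Qed.

(** Hoelder up to a factor [2], by a threshold: a term at most [mu] is bounded by [mu], and a larger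
    one by [c ^ q * mu ^ (1 - q)] because [q >= 1]. The parameter [mu] is optimized by the
    caller. *)
Lemma weighted_sum_le (T : eqType) (l : seq T) (c : T -> R) (q mu Q N : R) :
  1 <= q -> 0 < mu -> (forall i, 0 <= c i) -> (size l)%:R <= N ->
  \sum_(i <- l) c i `^ q <= Q -> \sum_(i <- l) c i <= N * mu + Q * mu `^ (1 - q).
Proof.
move=> q1 mu0 c0 lN lQ.
have cle i : c i <= mu + c i `^ q * mu `^ (1 - q).
  have [cmu|muc] := leP (c i) mu.
    by apply: le_trans cmu _; rewrite lerDl mulr_ge0 ?powR_ge0.
  have ci0 : 0 < c i := lt_trans mu0 muc.
  suff : c i <= c i `^ q * mu `^ (1 - q) by lra.
  rewrite -[leLHS]powRr1 ?(ltW ci0)// {1}(_ : 1 = q + (1 - q))//; last by ring.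
  rewrite powRD; last by rewrite (gt_eqF ci0) implybT.
  rewrite ler_pM2l ?powR_gt0//.
  rewrite -opprB 2!powRN lef_pV2 ?posrE ?powR_gt0//.
  by apply: ge0_ler_powR; rewrite ?nnegrE ?(ltW mu0) ?(ltW ci0) ?(ltW muc)//; lra.
apply: (@le_trans _ _ (\sum_(i <- l) (mu + c i `^ q * mu `^ (1 - q)))).
  by apply: ler_sum => a _; exact: cle.
rewrite big_split/= big_const_seq count_predT -mulr_suml.
rewrite iter_addr_0 -mulr_natl.
by apply: lerD; [rewrite ler_pM2r|rewrite ler_pM2r ?powR_gt0].
Qed.

Lemma antichain_bound s t p q P Q e (rho : R -> R) (l : seq (tree w)) :
  0 <= s -> s <= t -> t <= 1 -> 1 <= p -> 1 <= q -> 0 < P -> 0 < Q -> 0 < e ->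
  var_le p w s t (P `^ p) -> var_le q rho s t (Q `^ q) ->
  uniq l -> {in l &, forall a b, anc a b -> a = b} ->
  {in l, forall a, [/\ actL s t a, actR s t a & tall e a]} ->
  \sum_(a <- l) `|rho (tfirst a) - rho (tlast a)| <= 2 * Q * (e / P) `^ (p / q - p).
Proof.
move=> s0 st t1 p1 q1 P0 Q0 e0 wP rQ ul lanti lT.
have r0 : 0 < e / P by rewrite divr_gt0.
have fst a : a \in l -> s <= tfirst a /\ tlast a <= t.
  by move=> /lT[[_ /andP[/ltW ? _]] [_ /andP[_ ?]] _].
have disj a b x : a \in l -> b \in l -> a != b ->
    ~ (tfirst a <= x <= tlast a /\ tfirst b <= x <= tlast b).
  move=> al bl ab [ax bx]; move/eqP: ab; apply.
  by have [/lanti|/lanti h] := anc_overlap ax bx; [exact|apply/esym; exact: h].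
have sumQ : \sum_(a <- l) `|rho (tfirst a) - rho (tlast a)| `^ q <= Q `^ q.
  under eq_bigr do rewrite distrC.
  apply: (@var_le_family _ _ _ _ _ _ _ l (fun a => (tfirst a, tlast a)) st rQ) => //.
    by move=> a /fst[? ?] /=; rewrite tfirst_le_tlast.
  move=> a b al bl ab /=; have := tfirst_le_tlast a; have := tfirst_le_tlast b.
  case: (ltP (tlast a) (tfirst b)) => h1 h2 h3; first by left.
  right; rewrite ltNge; apply/negP => h4.
  case: (leP (tfirst a) (tfirst b)) => h5.
    by apply: (disj a b (tfirst b)) => //; lra.
  by apply: (disj a b (tfirst a)) => //; lra.
(* [X a] is a time of a descendant at height more than [e] above [a]. As it lies in the interval of
   [a], the intervals [[tfirst a, X a]] are disjoint too. *)
have [X XP] : exists X : tree w -> R, {in l, forall a, tfirst a <= X a <= tlast a /\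
    e <= w (X a) - w (tfirst a)}.
  have /choice[X XP] : forall a, exists x, a \in l -> tfirst a <= x <= tlast a /\
      e <= w x - w (tfirst a).
    move=> a; have [/lT[aL aR [x x01 [ax h]]]|] := pselect (a \in l); last by exists 0.
    exists x => _; split; first exact: act_both_witness aL aR _ _.
    move: h; rewrite -{1}(tp_tfirst a) !hgt_tp//; first by lra.
    exact: tfirst01.
  by exists X => a; exact: XP.
have sumP : \sum_(a <- l) `|w (X a) - w (tfirst a)| `^ p <= P `^ p.
  apply: (@var_le_family _ _ _ _ _ _ _ l (fun a => (tfirst a, X a)) st wP) => //.
    by move=> a al /=; have [? ?] := fst a al; have [? ?] := XP a al; lra.
  move=> a b al bl ab /=; have [? ?] := XP a al; have [? ?] := XP b bl.
  case: (ltP (X a) (tfirst b)) => h1; first by left.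
  right; rewrite ltNge; apply/negP => h4.
  case: (leP (tfirst a) (tfirst b)) => h5.
    by apply: (disj a b (tfirst b)) => //; lra.
  by apply: (disj a b (tfirst a)) => //; lra.
have sizeN : (size l)%:R <= (e / P) `^ (- p).
  rewrite powRN -div1r ler_pdivlMr ?powR_gt0//.
  rewrite -(@ler_pM2r _ (P `^ p)) ?powR_gt0// mul1r -mulrA -powRM ?(ltW r0) ?(ltW P0)//.
  rewrite divfK ?gt_eqF//.
  apply: le_trans sumP; rewrite mulr_natl -iter_addr_0 -count_predT -big_const_seq.
  rewrite big_seq [leRHS]big_seq; apply: ler_sum => a al.
  have [_ h] := XP a al.
  by rewrite ge0_ler_powR ?nnegrE ?(ltW e0)//; [lra|apply: le_trans (ler_norm _)].
(* This threshold makes the two terms of [weighted_sum_le] equal, whence the factor [2]. *)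
set mu := Q * (e / P) `^ (p / q).
have mu0 : 0 < mu by rewrite mulr_gt0// powR_gt0.
apply: le_trans (weighted_sum_le q1 mu0 _ sizeN sumQ) _ => //.
rewrite le_eqVlt; apply/orP; left; apply/eqP.
have q0 : q != 0 by rewrite gt_eqF//; lra.
rewrite /mu (@powRM _ Q) ?powR_ge0 ?(ltW Q0)// -powRrM.
rewrite [_ * (Q * _)]mulrCA -powRD; last by rewrite (gt_eqF r0) implybT.
rewrite mulrA -[Q `^ q * _]powRD; last by rewrite (gt_eqF Q0) implybT.
rewrite (_ : q + (1 - q) = 1); last by ring.
rewrite (_ : p / q * (1 - q) = p / q - p); last by rewrite mulrBr mulr1 divfK.
by rewrite (_ : - p + p / q = p / q - p) ?powRr1 ?(ltW Q0)//; ring.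
Qed.

End activity.

(** * Measurability on the tree *)

Section tree_measurability.
Context {R : realType} (w : cpath R).
Implicit Types (s t u x y e : R) (a b : tree w).
Local Notation TB := (tree_borel w).

Lemma open_tree_measurable (U : set (tree w)) : open U -> measurable (U : set TB).
Proof. by move=> oU; exact: sub_sigma_algebra. Qed.

Lemma closed_tree_measurable (F : set (tree w)) : closed F -> measurable (F : set TB).
Proof.
move=> cF; rewrite -[X in measurable X]setCK; apply: measurableC.
by apply: open_tree_measurable; exact: closed_openC.
Qed.

Lemma set1_tree_measurable b : measurable ([set b] : set TB).
Proof.
by apply: closed_tree_measurable; apply: accessible_closed_set1;
   apply: hausdorff_accessible; exact: metric_hausdorff.
Qed.

Lemma lipschitz_measurable (f : tree w -> R) :
  (forall a b, `|f a - f b| <= mdist a b) -> measurable_fun setT (f : TB -> R).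
Proof.
move=> fl mT; apply: (measurability _ (measurable_realfun.RGenOInfty.measurableE R)) => //.
move=> /= _ [_ [x ->] <-]; rewrite setTI; apply: open_tree_measurable.
rewrite openE => a /=; rewrite in_itv/= andbT => xa.
rewrite /interior; apply/nbhs_ballP; exists (f a - x) => /=; first by rewrite subr_gt0.
move=> b; rewrite ballEmdist/= in_itv/= andbT => ab.
by have := fl a b; have := ler_norm (f a - f b); lra.
Qed.

Lemma hgt_measurable : measurable_fun setT (@hgt R w : TB -> R).
Proof. by apply: lipschitz_measurable => a b; exact: hgt_lip. Qed.

Definition ancestors b : set TB := [set a | anc a b].

Lemma ancestors_measurable b : measurable (ancestors b).
Proof.
pose f (a : tree w) : R := mdist a b.
have mf : measurable_fun setT (f : TB -> R).
  apply: lipschitz_measurable => a a'; rewrite ler_norml /f.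
  have := metric_triangle a a' b; have := metric_triangle a' a b.
  by rewrite (metric_sym a' a); lra.
have mg : measurable_fun setT ((fun a => f a + hgt a) : TB -> R).
  by apply: measurable_funD => //; exact: hgt_measurable.
rewrite (_ : ancestors b = (fun a => f a + hgt a) @^-1` [set hgt b]).
  by rewrite -[X in measurable X]setTI; apply: mg => //; exact: measurable_set1.
by apply/seteqP; split => a; rewrite /ancestors /anc /f /=; lra.
Qed.

Lemma mdist_tp_near x e : 0 <= x <= 1 -> 0 < e -> exists2 d, 0 < d &
  forall y, 0 <= y <= 1 -> `|y - x| < d -> mdist (tp w x) (tp w y) < e.
Proof.
move=> x01 e0; have [|d d0 dP] := @cpath_cont01 R w x x01 (e / 3); first by lra.
exists d => // y y01 yx; rewrite mdist_tp// /delta.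
have [c cxy cP] := argmin_btw w x01 y01; rewrite (path_minE x01 y01 cxy cP).
have cx : `|c - x| < d.
  by move: yx cxy; rewrite !ltr_norml /btw; lra.
have := dP y y01 yx; have := dP c (btw01 x01 y01 cxy) cx.
by rewrite !ltr_norml; lra.
Qed.

Lemma tp_image_closed x y : 0 <= x -> y <= 1 -> closed (tp w @` `[x, y]).
Proof.
move=> x0 y1; apply: compact_closed; first exact: metric_hausdorff.
apply: continuous_compact; last exact: segment_compact.
apply/subspace_continuousP => z; rewrite /= in_itv/= => zxy.
apply/cvg_ballP => e e0; rewrite near_withinE.
have [|d d0 dP] := @mdist_tp_near z e _ e0; first by lra.
exists d => // u /= zu; rewrite in_itv/= => uxy; rewrite ballEmdist/=.
by apply: dP; [lra|rewrite distrC].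
Qed.

(** [tfirst a <= x] means that [a] is visited no later than [x], that is, [a] is in the image of a
    compact interval of times, which is closed. *)
Lemma tfirst_measurable : measurable_fun setT (@tfirst R w : TB -> R).
Proof.
move=> mT; apply: (measurability _ (measurable_realfun.RGenOInfty.measurableE R)) => //.
move=> /= _ [_ [x ->] <-]; rewrite setTI.
rewrite [X in measurable X](_ : _ = ~` (tp w @` `[0, Num.min x 1])).
  apply: measurableC; apply: closed_tree_measurable; apply: tp_image_closed => //.
  by rewrite ge_min lexx orbT.
apply/seteqP; split => a /=.
  rewrite in_itv/= andbT => xa [t]; rewrite in_itv/= le_min => /andP[t0 /andP[tx t1]] ta.
  by have := tfirst_le _ ta; rewrite t0 t1 => /(_ isT); lra.
rewrite in_itv/= andbT => h; rewrite ltNge; apply/negP => ax; apply: h.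
exists (tfirst a); last exact: tp_tfirst.
by rewrite in_itv/= le_min ax; have := tfirst01 a; lra.
Qed.

Lemma tlast_measurable : measurable_fun setT (@tlast R w : TB -> R).
Proof.
move=> mT; apply: (measurability _ (measurable_realfun.RGenCInfty.measurableE R)) => //.
move=> /= _ [_ [x ->] <-]; rewrite setTI.
rewrite [X in measurable X](_ : _ = tp w @` `[Num.max x 0, 1]).
  apply: closed_tree_measurable; apply: tp_image_closed => //.
  by rewrite le_max lexx orbT.
apply/seteqP; split => a /=.
  rewrite in_itv/= andbT => xa; exists (tlast a); last exact: tp_tlast.
  by rewrite in_itv/= ge_max xa; have := tlast01 a; lra.
move=> [t]; rewrite in_itv/= ge_max => /andP[/andP[xt t0] t1] ta.
by rewrite in_itv/= andbT; have := tlast_ge _ ta; rewrite t0 t1 => /(_ isT); lra.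
Qed.

Lemma actL_measurable s t : measurable ([set a | actL s t a] : set TB).
Proof.
rewrite (_ : [set a | _] = ~` ancestors (tree_A w) `&` (@tfirst R w) @^-1` `]s, t]).
  apply: measurableI; first by apply: measurableC; exact: ancestors_measurable.
  by rewrite -[X in measurable X]setTI; apply: tfirst_measurable => //; exact: measurable_itv.
by apply/seteqP; split => a; rewrite /actL /= in_itv.
Qed.

Lemma actR_measurable s t : measurable ([set a | actR s t a] : set TB).
Proof.
rewrite (_ : [set a | _] = ~` ancestors (tree_B w) `&` (@tlast R w) @^-1` `]s, t]).
  apply: measurableI; first by apply: measurableC; exact: ancestors_measurable.
  by rewrite -[X in measurable X]setTI; apply: tlast_measurable => //; exact: measurable_itv.
by apply/seteqP; split => a; rewrite /actR /= in_itv.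
Qed.

(** An enumeration of the rational times; indices that decode to nothing give the time [0]. *)
Definition rat_time (i : nat) : R := ratr (odflt 0%R (unpickle i : option rat)).

Definition branch_pt (i : nat) : tree w := tp w (rat_time i).

Lemma rat_time_dense x y : x < y -> exists i, x < rat_time i < y.
Proof.
move=> /rat_in_itvoo[q]; rewrite in_itv/= => qxy; exists (pickle q).
by rewrite /rat_time pickleK.
Qed.

Lemma branch_ptE i : exists2 x, 0 <= x <= 1 & branch_pt i = tp w x.
Proof. by have [x x01 <-] := tp_surj (branch_pt i); exists x. Qed.

(** The inequality in [tall] is strict, so by continuity the witness can be moved to a nearby
    rational time without [w] coming down to the level of [a] in between. Countably many branches
    thus reach every point that is not a leaf. *)
Lemma tall_bigcup e : 0 <= e -> tall e =
  \bigcup_i [set a | anc a (branch_pt i) /\ hgt a + e < hgt (branch_pt i)].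
Proof.
move=> e0; apply/seteqP; split => a; last first.
  by move=> [i _ /= [ai hi]]; have [x x01 xi] := branch_ptE i; exists x; rewrite // -xi.
move=> [x x01]; have f01 := tfirst01 a.
rewrite -{1 2}(tp_tfirst a) !hgt_tp// => -[/anc_tp ax h].
have {}ax := ax f01 x01.
have [|d d0 dP] := @cpath_cont01 R w x x01 (w x - w (tfirst a) - e); first by lra.
have [i xi] : exists i, Num.max 0 (x - d) < rat_time i < Num.min 1 (x + d).
  by apply: rat_time_dense; rewrite gt_max !lt_min; apply/andP; split; apply/andP; split; lra.
move: xi; rewrite gt_max lt_min => /andP[/andP[i0 xi] /andP[i1 ix]].
have i01 : 0 <= rat_time i <= 1 by rewrite !ltW.
exists i => //=; rewrite /branch_pt -{1 2}(tp_tfirst a) !hgt_tp//; split; last first.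
  by have := dP _ i01; rewrite !ltr_norml => /(_ ltac:(lra)); lra.
apply/anc_tp => // y /(@btw_split _ _ x)[|xy]; first exact: ax.
have := dP y (btw01 x01 i01 xy); rewrite !ltr_norml => dy.
by have := dy ltac:(move: xy; rewrite /btw; lra); lra.
Qed.

Lemma tall_measurable e : 0 <= e -> measurable (tall e : set TB).
Proof.
move=> e0; rewrite tall_bigcup//; apply: (@bigcup_measurable _ TB) => i _.
rewrite (_ : [set a | _] = ancestors (branch_pt i) `&`
    (@hgt R w) @^-1` `]-oo, hgt (branch_pt i) - e[).
  apply: measurableI; first exact: ancestors_measurable.
  by rewrite -[X in measurable X]setTI; apply: hgt_measurable => //; exact: measurable_itv.
by apply/seteqP; split => a /=; rewrite in_itv/= => -[? ?]; split => //; lra.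
Qed.

Lemma leavesE : @leaves R w = ~` tall 0.
Proof.
apply/seteqP; split => a.
  move=> al [x x01 [ax h]]; apply: (al (tp w x)).
    by move=> xa; move: h; rewrite xa addr0 ltxx.
  exact/tree_arcO.
move=> na b ba /tree_arcO ab; apply: na.
have [x x01 xb] := tp_surj b; exists x => //; rewrite xb addr0; split => //.
rewrite lt_neqAle anc_hgt// andbT; apply/eqP => h; apply: ba.
by apply/esym; exact: anc_eq.
Qed.

Lemma Drho_measurable (rho : R -> R) : measurable_fun (`[0, 1] : set R) rho ->
  measurable_fun setT (Drho w rho : TB -> R).
Proof.
move=> mrho; rewrite (_ : Drho w rho = fun a =>
  \1_(~` ancestors (tree_A w)) a * (rho \_ `[0, 1]) (tfirst a) -
  \1_(~` ancestors (tree_B w)) a * (rho \_ `[0, 1]) (tlast a)).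
  have mr : measurable_fun setT (rho \_ `[0, 1]).
    by apply/(measurable_restrictT _ _).1 => //; exact: measurable_itv.
  apply: measurable_funB; apply: measurable_funM.
  - by apply: measurable_indic; apply: measurableC; exact: ancestors_measurable.
  - by apply: measurableT_comp => //; exact: tfirst_measurable.
  - by apply: measurable_indic; apply: measurableC; exact: ancestors_measurable.
  - by apply: measurableT_comp => //; exact: tlast_measurable.
have in01 x : 0 <= x <= 1 -> x \in [set` `[0, 1]] by move=> ?; rewrite mem_set//= in_itv.
apply/funext => a; rewrite /Drho !patchE !in01 ?tfirst01 ?tlast01// !indicE !in_setC.
congr (_ - _); case: ifPn => [/set_mem /tree_arcO aA|/negP aA].
- by rewrite mem_set// mul0r.
- by rewrite memNset ?mul1r// => /tree_arcO h; apply: aA; exact: mem_set.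
- by rewrite mem_set// mul0r.
- by rewrite memNset ?mul1r// => /tree_arcO h; apply: aA; exact: mem_set.
Qed.

Lemma Drho_indic_measurable (rho : R -> R) s t : measurable_fun (`[0, 1] : set R) rho ->
  measurable_fun setT ((Drho w (fun x => rho x * \1_(`]s, t]) x)) : TB -> R).
Proof.
move=> mrho; apply: Drho_measurable; exact: measurable_funM.
Qed.

End tree_measurability.

(** * Length measure along branches *)

Section length_on_branches.
Context {R : realType} (w : cpath R) (lam : {measure set (tree_borel w) -> \bar R}).
Hypothesis hlam : length_measure lam.
Implicit Types (s t u x y e : R) (a b c : tree w).
Local Notation TB := (tree_borel w).
Local Notation MR := (measurableTypeR R).

Lemma length_ancestors b : lam (ancestors b) = (hgt b)%:E.
Proof.
rewrite -(hlam.2 (tree_O w) b); congr (lam _).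
by apply/seteqP; split => a /= /tree_arcO.
Qed.

Lemma length_set1 b : lam [set b] = 0%E.
Proof.
have <- : tree_arc b b = [set b]; last by rewrite hlam.2 mdistxx.
apply/seteqP; split => a /=.
  move=> [g [g0 _ _]]; rewrite mdistxx => -[x /=]; rewrite in_itv/= => x0 <-.
  by rewrite (_ : x = 0)//; lra.
move=> ->; exists (fun=> b); last by exists 0; rewrite //= in_itv/= mdistxx lexx.
split => // x y; rewrite mdistxx !in_itv/= => x0 y0.
have -> : x = 0 by lra.
have -> : y = 0 by lra.
by rewrite subr0 normr0.
Qed.

Lemma length_ancestorsD b c : anc c b ->
  lam (ancestors b `\` ancestors c) = (hgt b - hgt c)%:E.
Proof.
move=> cb; have D : lam (ancestors b `\` ancestors c) =
    (lam (ancestors b) - lam (ancestors b `&` ancestors c))%E.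
  apply: measureD; [exact: ancestors_measurable|exact: ancestors_measurable|].
  by have := length_ancestors b; rewrite /= => ->; rewrite ltry.
rewrite D setIidr; first by rewrite !length_ancestors.
by move=> a ac; exact: anc_trans ac cb.
Qed.

(** What remains of the branch of [t] is the part above the last common ancestor. *)
Lemma length_ancD s t : 0 <= s <= 1 -> 0 <= t <= 1 ->
  lam (ancestors (tp w t) `\` ancestors (tp w s)) = (w t - path_min w s t)%:E.
Proof.
move=> s01 t01; have [c [c01 ->] cP] := anc_meet w s01 t01.
have [_ ct] : anc (tp w c) (tp w s) /\ anc (tp w c) (tp w t) by apply/cP; exact: anc_refl.
rewrite (_ : _ `\` _ = ancestors (tp w t) `\` ancestors (tp w c)).
  by rewrite length_ancestorsD// !hgt_tp//; congr EFin; ring.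
apply/seteqP; split => a [/= at_ nas]; split => // ac; apply: nas.
  by have [] := (cP a).2 ac.
exact/cP.
Qed.

Lemma branch_measurable b y : measurable_fun setT ((fun u => branch b (y + u)) : MR -> TB).
Proof.
suff: preimage_set_system setT (fun u : R => branch b (y + u)) (@open (tree w)) `<=`
    @measurable _ MR.
  exact: (@measurability _ _ MR TB setT (fun u : R => branch b (y + u)) (@open (tree w)) erefl).
move=> _ [U oU <-]; rewrite setTI; apply: open_measurable.
rewrite openE => u /= Uu; rewrite /interior.
move: oU; rewrite openE => /(_ _ Uu); rewrite /interior => /nbhs_ballP[e /= e0 eU].
apply/nbhs_ballP; exists e => //= v uv; apply: eU; rewrite ballEmdist/=.
apply: le_lt_trans (branch_lip _ _ _) _.
by rewrite (_ : y + u - (y + v) = u - v)//; ring.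
Qed.

Section one_branch.
Variables (b : tree w) (y : R).

Let phi : TB -> MR := fun a => hgt a - y.

Let mphi : measurable_fun setT phi.
Proof.
suff h : measurable_fun setT ((fun a => hgt a - y) : TB -> R) by exact: h.
by apply: measurable_funB => //; exact: hgt_measurable.
Qed.

Let mb : measurable (ancestors b) := ancestors_measurable b.

Let lam_b : {measure set TB -> \bar R} := mrestr lam mb.

Let nu : {measure set MR -> \bar R} :=
  measure_function_pushforward__canonical__measure_function_Measure lam_b mphi.

Let mI : measurable (`[- y, hgt b - y]%classic : set MR).
Proof. exact: measurable_itv. Qed.

Let leb : {measure set MR -> \bar R} := @lebesgue_measure R.
Let leb_b : {measure set MR -> \bar R} := mrestr leb mI.

(** The shifted height carries the length on the branch to Lebesgue measure on an interval. It
    suffices to compare on rays []x, +oo[], a generating family stable under intersection: above a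
    given height, the branch of [b] is the difference of two sets of ancestors. *)
Let nu_leb (X : set MR) : measurable X -> nu X = leb_b X.
Proof.
have hb := hgt_ge0 b.
apply: (@measure_unique _ _ MR (@measurable_realfun.RGenOInfty.G R)
  (fun n => `](- n%:R), +oo[%classic)).
- exact: measurable_realfun.RGenOInfty.measurableE.
- move=> _ _ [x ->] [x' ->]; exists (Num.max x x').
  by apply/seteqP; split => z /=; rewrite !in_itv/= !andbT gt_max => /andP.
- by move=> n; exists (- n%:R).
- rewrite -subTset => x _ /=; exists (Num.truncn (- x)).+1 => //=.
  by rewrite in_itv/= andbT ltrNl truncnS_gt.
- move=> _ [x ->]; rewrite /nu /leb_b /= /pushforward /mrestr.
  have [z0|z0] := ltP (x + y) 0; last have [zh|hz] := ltP (x + y) (hgt b).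
  + rewrite [X in lam X = _](_ : _ = ancestors b); last first.
      apply/seteqP; split => a /=; first by case.
      by move=> ab; split => //; rewrite in_itv/= andbT /phi; have := hgt_ge0 a; lra.
    rewrite [X in _ = lebesgue_measure X](_ : _ = `[- y, hgt b - y]%classic); last first.
      apply/seteqP; split => u /=; rewrite !in_itv/= ?andbT; first by case.
      by move=> uI; split => //; lra.
    rewrite length_ancestors lebesgue_measure_itv/= lte_fin.
    case: ltP => h; first by rewrite -EFinB; congr EFin; ring.
    by congr EFin; lra.
  + have hz : hgt (branch b (x + y)) = x + y by rewrite hgt_branch// z0 ltW.
    rewrite [X in lam X = _](_ : _ = ancestors b `\` ancestors (branch b (x + y))).
      rewrite length_ancestorsD ?hz; last exact: branch_anc.
      rewrite [X in _ = lebesgue_measure X](_ : _ = `]x, hgt b - y]%classic).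
        rewrite lebesgue_measure_itv/= lte_fin ltrBrDr zh -!EFinB; congr EFin; ring.
      apply/seteqP; split => u /=; rewrite !in_itv/= ?andbT; first by move=> [? ?]; lra.
      by move=> ?; split; lra.
    apply/seteqP; split => a /=; rewrite in_itv/= andbT /phi.
      by move=> [xa ab]; split => // /anc_hgt; rewrite hz; lra.
    move=> [ab nab]; split => //; rewrite ltrBrDr ltNge; apply/negP => h; apply: nab.
    by apply: anc_comparable ab (branch_anc _ _) _; rewrite hz.
  + rewrite [X in lam X = _](_ : _ = set0); last first.
      apply/seteqP; split => a //=; rewrite in_itv/= andbT /phi => -[xa /anc_hgt].
      by lra.
    rewrite [X in _ = lebesgue_measure X](_ : _ = set0) ?measure0//.
    by apply/seteqP; split => u //=; rewrite !in_itv/= ?andbT => -[? ?]; lra.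
- move=> n; rewrite /nu /= /pushforward /mrestr.
  apply: (@le_lt_trans _ _ (lam (ancestors b))).
    apply: le_measure; rewrite ?inE; [|exact: mb|exact: subIsetr].
    apply: measurableI => //; rewrite -[X in measurable X]setTI.
    by apply: mphi => //; exact: measurable_itv.
  by rewrite length_ancestors ltry.
Qed.

(** Change of variable [u = hgt a - y]. Measuring heights from the bottom [y] of the slab gives the
    same domain [(0, e]] to slabs at all levels, which can then be added under one integral. *)
Lemma integral_branch_le e (f : TB -> \bar R) : 0 < e ->
  measurable_fun setT f -> (forall a, 0 <= f a)%E ->
  (\int[lam]_(a in [set a | anc a b /\ (y < hgt a <= y + e)%R]) f a <=
   \int[@lebesgue_measure R]_(u in `]0%R, e])
     ((fun u => f (branch b (y + u)%R)) \_ `[(- y)%R, (hgt b - y)%R]) u)%E.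
Proof.
move=> e0 mf f0; pose F u := f (branch b (y + u)).
have mF : measurable_fun setT F by apply: measurableT_comp mf _; exact: branch_measurable.
pose J : set MR := `]0, e]%classic `&` `[- y, hgt b - y]%classic.
have mJ : measurable J by apply: measurableI; exact: measurable_itv.
have mphiJ : measurable (phi @^-1` J).
  by rewrite -[X in measurable X]setTI; exact: mphi.
rewrite [X in integral _ X _](_ : _ = ancestors b `&` phi @^-1` J); last first.
  apply/seteqP; split => a /=; rewrite /J /phi /= !in_itv/=.
    by move=> [ab ?]; split => //; have := anc_hgt ab; have := hgt_ge0 a; split; lra.
  by move=> [ab [? ?]]; split => //; lra.
set D := _ `&` _; have mD : measurable D by exact: measurableI.
rewrite (@eq_measure_integral _ _ _ D lam_b lam); last first.
  by move=> A mA AD; rewrite /lam_b/= /mrestr setIidl// => a /AD[].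
rewrite (eq_integral (F \o phi)); last first.
  move=> a /set_mem[/= ab _]; rewrite /F/= /phi.
  by rewrite (_ : y + (hgt a - y) = hgt a) ?branch_hgt//; ring.
apply: (@le_trans _ _ (\int[lam_b]_(a in phi @^-1` J) (F \o phi) a)%E).
  apply: ge0_subset_integral => //.
  - by apply: measurable_funTS; exact: measurableT_comp.
  - by move=> a _; exact: f0.
  - by move=> a [].
rewrite -(ge0_integral_pushforward mphi lam_b mJ (measurable_funTS mF)); last first.
  by move=> u _; exact: f0.
rewrite (@eq_measure_integral _ _ _ J (@lebesgue_measure R)); last first.
  by move=> A mA AJ; rewrite -/(nu A) nu_leb//= /leb_b /mrestr setIidl// => u /AJ[].
by rewrite /J integral_mkcondr.
Qed.

End one_branch.
End length_on_branches.

(** * Integration over a slice, residue by residue *)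

Section slices.
Context {R : realType} (w : cpath R) (lam : {measure set (tree_borel w) -> \bar R}).
Hypothesis hlam : length_measure lam.
Implicit Types (a b : tree w).
Local Notation TB := (tree_borel w).
Local Notation MR := (measurableTypeR R).

Variables (S : set TB) (g : TB -> R) (e K : R).
Hypotheses (mS : measurable S) (mg : measurable_fun setT g) (g0 : forall a, 0 <= g a).
Hypotheses (e0 : 0 < e) (K0 : 0 <= K).
Hypothesis S_tall : S `<=` tall e `\` tall (2 * e).
Hypothesis S_hgt : forall a, S a -> 0 < hgt a.
Hypothesis antichain_le : forall l : seq (tree w), uniq l ->
  {in l &, forall a b, anc a b -> a = b} -> {in l, forall a, S a} ->
  \sum_(a <- l) g a <= K.

Let succE n : n.+1%:R * e = n%:R * e + e. Proof. by rewrite -natr1 mulrDl mul1r. Qed.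

(** One index encodes a rational branch and a level. Repetitions caused by the default value are
    harmless, since [seqDU] makes the pieces disjoint. *)
Let idx (k : nat) : nat * nat := odflt (0%N, 0%N) (unpickle k).
Let tip k : tree w := branch_pt w (idx k).1.
Let low k : R := (idx k).2%:R * e.

Let A k : set TB := [set a | anc a (tip k) /\ low k < hgt a <= low k + e].

Let mA k : measurable (A k).
Proof.
rewrite (_ : A k = ancestors (tip k) `&` (@hgt R w) @^-1` `]low k, low k + e]).
  apply: measurableI; first exact: ancestors_measurable.
  by rewrite -[X in measurable X]setTI; apply: hgt_measurable => //; exact: measurable_itv.
by apply/seteqP; split => a; rewrite /A /= in_itv.
Qed.

Let E k : set TB := seqDU A k.

Let mE k : measurable (E k).
Proof. by apply: measurableD => //; exact: bigsetU_measurable. Qed.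

Let mSE k : measurable (S `&` E k).
Proof. exact: measurableI. Qed.

(** A point of [S], being tall, is an ancestor of the end of a rational branch; its height, being
    positive, falls in some slab [(j e, j e + e]]. *)
Let S_cover : S = \bigcup_k (S `&` E k).
Proof.
rewrite -setI_bigcupr -seqDU_bigcup_eq; apply/esym/setIidl => a Sa.
have [ta _] := S_tall Sa; have h0 := S_hgt Sa.
move: ta; rewrite tall_bigcup ?(ltW e0)// => -[i _ /= [ai _]].
have [j hj] : exists j : nat, j%:R * e < hgt a <= j%:R * e + e.
  have hex : exists n, hgt a <= n%:R * e.
    exists (Num.truncn (hgt a / e)).+1.
    by rewrite -ler_pdivrMr// ltW// truncnS_gt.
  case: (ex_minnP hex) => -[|n] hn nmin; first by move: hn h0; rewrite mul0r; lra.
  exists n; rewrite -succE hn andbT ltNge; apply/negP => /nmin.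
  by rewrite ltnn.
exists (pickle (i, j)) => //; rewrite /A /low /tip /idx pickleK /=.
by rewrite hj.
Qed.

Let pt k (u : MR) : tree w := branch (tip k) (low k + u).

(** The bounds on [u] exclude the clamping of [branch], so that [pt k u] has height [low k + u]. *)
Let cond k (u : MR) : bool :=
  `[< (S `&` E k) (pt k u) /\ - low k <= u <= hgt (tip k) - low k >].

Let G k (u : MR) : \bar R := if cond k u then (g (pt k u))%:E else 0%E.

Let G_patch k : G k = (fun u => ((EFin \o g) \_ (S `&` E k)) (branch (tip k) (low k + u)%R))
   \_ `[(- low k)%R, (hgt (tip k) - low k)%R].
Proof.
apply/funext => u; rewrite /G /cond patchE.
case: asboolP => [[SE uI]|nSE]; first by rewrite mem_set/= ?in_itv// patchE mem_set.
case: ifPn => // /set_mem/=; rewrite in_itv/= => uI; rewrite patchE memNset// => SE.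
exact: nSE.
Qed.

Let mG k : measurable_fun setT (G k).
Proof.
rewrite G_patch; apply/(measurable_restrictT _ _).1; first exact: measurable_itv.
apply: measurable_funTS.
have mf : measurable_fun setT ((EFin \o g) \_ (S `&` E k)).
  apply/(measurable_restrictT _ _).1; first exact: mSE.
  by apply: measurable_funTS; exact/measurable_EFinP.
exact: measurableT_comp mf (branch_measurable _ _).
Qed.

Let G_ge0 k u : (0 <= G k u)%E.
Proof. by rewrite /G; case: ifP => // _; rewrite lee_fin. Qed.

Let piece_le k : (\int[lam]_(a in S `&` E k) (g a)%:E <=
  \int[@lebesgue_measure R]_(u in `]0%R, e]) G k u)%E.
Proof.
have EA : E k `<=` A k by move=> a [].
rewrite (_ : S `&` E k = A k `&` (S `&` E k)); last first.
  by apply/esym/setIidr => a [_ /EA].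
rewrite integral_mkcondr G_patch.
apply: integral_branch_le => //.
  apply/(measurable_restrictT _ _).1; first exact: mSE.
  by apply: measurable_funTS; exact/measurable_EFinP.
by move=> a; rewrite patchE; case: ifP => // _; rewrite lee_fin.
Qed.

Let cond_hgt k u : cond k u -> hgt (pt k u) = low k + u.
Proof. by move=> /asboolP[_ ?]; apply: hgt_branch; lra. Qed.

Let cond_S k u : cond k u -> S (pt k u).
Proof. by move=> /asboolP[[]]. Qed.

Let pt_inj u : {in [pred k | cond k u] &, injective (pt^~ u)}.
Proof.
move=> k k' /asboolP[[_ Ek] _] /asboolP[[_ Ek'] _] pkk.
have /trivIsetP/(_ k k' I I) := @trivIset_seqDU _ A.
have [//|kk] := eqVneq k k' => /(_ isT) /seteqP[/(_ (pt k u))] /=.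
move=> h _; exfalso; apply: h; split; [exact: Ek|rewrite pkk; exact: Ek'].
Qed.

(* Points of the family whose heights differ by a multiple of [e] cannot be
   comparable: the lower one would carry a subtree of height more than [2 * e]. *)
Let pt_antichain u k k' : cond k u -> cond k' u -> anc (pt k u) (pt k' u) ->
  pt k u = pt k' u.
Proof.
move=> ck ck' kk; apply: (anc_eq kk); have := anc_hgt kk.
rewrite !cond_hgt// lerD2r /low => jj.
have {}jj : ((idx k).2 <= (idx k').2)%N by rewrite -(ler_nat R) -(ler_pM2r e0).
move: jj; rewrite leq_eqVlt => /orP[/eqP jj|jj]; first by rewrite jj.
exfalso.
have [_] := S_tall (cond_S ck); apply.
have [tk' _] := S_tall (cond_S ck').
apply: tall_le (tall_anc kk tk'); rewrite !cond_hgt// /low.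
have : (idx k).2.+1%:R * e <= (idx k').2%:R * e by rewrite ler_pM2r// ler_nat.
by rewrite succE; lra.
Qed.

(** For fixed [u] the selected points are distinct, as the pieces are disjoint, and form an
    antichain in [S]; hence a bound uniform in [n] that can be integrated over [u]. *)
Let sum_G_le n u : (\sum_(0 <= k < n) G k u <= K%:E)%E.
Proof.
pose r := [seq k <- index_iota 0 n | cond k u].
rewrite -big_mkcond /= -big_filter sumEFin lee_fin -(big_map (pt^~ u) predT g).
apply: antichain_le.
- rewrite map_inj_in_uniq; first by rewrite filter_uniq// iota_uniq.
  by move=> k k'; rewrite !mem_filter => /andP[ck _] /andP[ck' _]; exact: pt_inj.
- move=> _ _ /mapP[k + ->] /mapP[k' + ->]; rewrite !mem_filter => /andP[ck _] /andP[ck' _].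
  exact: pt_antichain.
- by move=> _ /mapP[k + ->]; rewrite mem_filter => /andP[ck _]; exact: cond_S.
Qed.

Lemma slice_integral_le : (\int[lam]_(a in S) (g a)%:E <= (e * K)%:E)%E.
Proof.
rewrite S_cover ge0_integral_bigcup//; last 3 first.
- by apply: measurable_funTS; exact/measurable_EFinP.
- by move=> a _; rewrite lee_fin.
- by apply: trivIset_setIl; exact: trivIset_seqDU.
apply: lime_le.
  by apply: is_cvg_nneseries => k _ _; apply: integral_ge0 => a _; rewrite lee_fin.
apply: nearW => n.
apply: (@le_trans _ _ (\sum_(0 <= k < n) \int[@lebesgue_measure R]_(u in `]0%R, e]) G k u)%E).
  by apply: lee_sum => k _; exact: piece_le.
rewrite -ge0_integral_sum//; last by move=> k; exact: measurable_funTS (mG k).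
apply: (@le_trans _ _ (\int[@lebesgue_measure R]_(u in `]0%R, e]) cst K%:E u)%E).
  apply: ge0_le_integral => //.
  - by move=> u _; apply: sume_ge0.
  - by apply: emeasurable_sum => k; exact: measurable_funTS (mG k).
rewrite integral_cst; last exact: measurable_itv.
have le : lebesgue_measure (`]0, e]%classic : set R) = e%:E.
  by rewrite lebesgue_measure_itv/= lte_fin e0 sube0.
by rewrite muleC [X in (X * _)%E]le.
Qed.

End slices.

(** * Young's estimate *)

Section main_bound.
Context {R : realType}.

(* The ratio of the geometric series of the slices of heights [2 ^ -k * P]. *)
Definition young_rate (p q : R) : R := 2^-1 `^ (1 + p / q - p).

(** The first term sums the slices; the second accounts for the two portions of branches where only
    one extreme time counts, each of length at most [V_p(w) ^ (1/p)]. Adding them gives a single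
    constant in front of both terms of the bound. *)
Definition young_const (p q : R) : R := 2 / (1 - young_rate p q) + 2.

(** The exponent is [p (1/p + 1/q - 1)], positive exactly by the Young condition. *)
Lemma young_rate_itv (p q : R) : 1 <= p -> 1 <= q -> 1 < p^-1 + q^-1 ->
  0 < young_rate p q < 1.
Proof.
move=> p1 q1 pq; rewrite powR_gt0 ?invr_gt0//=.
have h : 0 < 1 + p / q - p.
  rewrite (_ : _ - _ = p * (p^-1 + q^-1 - 1)); first by rewrite mulr_gt0 ?subr_gt0//; lra.
  by rewrite mulrBr mulrDr mulr1 divff// gt_eqF//; lra.
have := @gt0_ltr_powR R _ h 2^-1 1; rewrite powR1 !nnegrE; apply; lra.
Qed.

Lemma young_const_ge (p q : R) : 1 <= p -> 1 <= q -> 1 < p^-1 + q^-1 ->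
  2 / (1 - young_rate p q) <= young_const p q /\ 2 <= young_const p q.
Proof.
move=> p1 q1 pq; have /andP[z0 z1] := young_rate_itv p1 q1 pq.
have : 0 <= 2 / (1 - young_rate p q) by rewrite divr_ge0//; lra.
by rewrite /young_const; lra.
Qed.

Lemma powR_le_cancel (p x y : R) : 0 < p -> 0 <= x -> 0 <= y -> x `^ p <= y `^ p -> x <= y.
Proof.
move=> p0 x0 y0; rewrite leNgt => /negP h; rewrite leNgt; apply/negP => yx; apply: h.
exact: gt0_ltr_powR.
Qed.

Lemma geometric_sum_le (z : R) n : 0 < z < 1 -> \sum_(0 <= k < n) z ^+ k.+1 <= (1 - z)^-1.
Proof.
move=> /andP[z0 z1]; have z10 : 0 < 1 - z by lra.
suff : (1 - z) * \sum_(0 <= k < n) z ^+ k.+1 = z - z ^+ n.+1.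
  move=> h; rewrite -[leRHS]mul1r ler_pdivlMr// mulrC h.
  by have := exprn_ge0 n.+1 (ltW z0); lra.
elim: n => [|n ih]; first by rewrite big_geq// mulr0 expr1 subrr.
by rewrite big_nat_recr//= mulrDr ih [z ^+ n.+2]exprS; ring.
Qed.

Lemma dyadic_small (P h : R) : 0 < P -> 0 < h -> exists n, P * 2^-1 ^+ n < h.
Proof.
move=> P0 h0; have := truncnS_gt (P / h); set n := (Num.truncn (P / h)).+1 => Pn.
exists n; rewrite exprVn ltr_pdivrMr ?exprn_gt0// mulrC -ltr_pdivrMr//.
by apply: lt_trans Pn _; rewrite -natrX ltr_nat ltn_expl.
Qed.

Variables (w : cpath R) (lam : {measure set (tree_borel w) -> \bar R}).
Hypothesis hlam : length_measure lam.
Local Notation TB := (tree_borel w).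

Variables (rho : R -> R) (s t p q P Q S : R).
Hypotheses (mrho : measurable_fun (`[0, 1] : set R) rho).
Hypotheses (s0 : 0 <= s) (st : s <= t) (t1 : t <= 1).
Hypotheses (p1 : 1 <= p) (q1 : 1 <= q) (pq : 1 < p^-1 + q^-1).
Hypotheses (P0 : 0 < P) (Q0 : 0 < Q) (S0 : 0 <= S).
Hypotheses (wP : var_le p w s t (P `^ p)) (rQ : var_le q rho s t (Q `^ q)).
Hypothesis rS : forall x, s <= x <= t -> `|rho x| <= S.

Let s01 : 0 <= s <= 1. Proof. by rewrite s0 (le_trans st). Qed.
Let t01 : 0 <= t <= 1. Proof. by rewrite t1 (le_trans s0). Qed.

Let both : set TB := [set a | actL s t a] `&` [set a | actR s t a].

Let mboth : measurable both.
Proof. by apply: measurableI; [exact: actL_measurable|exact: actR_measurable]. Qed.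

Let g (a : TB) : R := `|rho (tfirst a) - rho (tlast a)|.

Let mg : measurable_fun setT g.
Proof.
have mr : measurable_fun setT (rho \_ `[0, 1]).
  by apply/(measurable_restrictT _ _).1 => //; exact: measurable_itv.
have in01 x : 0 <= x <= 1 -> x \in [set` `[0, 1]] by move=> ?; rewrite mem_set//= in_itv.
rewrite (_ : g = (fun a => `|(rho \_ `[0, 1]) (tfirst a) - (rho \_ `[0, 1]) (tlast a)|)).
  apply: measurableT_comp => //; apply: measurable_funB.
    by apply: measurableT_comp => //; exact: tfirst_measurable.
  by apply: measurableT_comp => //; exact: tlast_measurable.
by apply/funext => a; rewrite !patchE !in01 ?tfirst01 ?tlast01.
Qed.

Let g0 a : 0 <= g a. Proof. exact: normr_ge0. Qed.

(** The scale starts at [2 * eps 0 = P]: no point of [both] carries a subtree higher than [P], since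
    the oscillation of [w] on [[s, t]] is at most [P]. *)
Let eps k : R := P * 2^-1 ^+ k.+1.

Let eps0 k : 0 < eps k.
Proof. by rewrite mulr_gt0// exprn_gt0// invr_gt0. Qed.

Let eps2 k : 2 * eps k = P * 2^-1 ^+ k.
Proof. by rewrite /eps exprS mulrCA mulVKf. Qed.

Let slice k : set TB := both `&` (tall (eps k) `\` tall (2 * eps k)).

Let mslice k : measurable (slice k).
Proof.
apply: measurableI => //; apply: measurableD; apply: tall_measurable.
  exact: ltW.
by rewrite mulr_ge0// ltW.
Qed.

Let slice_le k : (\int[lam]_(a in slice k) (g a)%:E <=
  (2 * P * Q * young_rate p q ^+ k.+1)%:E)%E.
Proof.
have -> : 2 * P * Q * young_rate p q ^+ k.+1 =
    eps k * (2 * Q * (eps k / P) `^ (p / q - p)).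
  have -> : eps k / P = 2^-1 ^+ k.+1 by rewrite /eps mulrAC divff ?mul1r// gt_eqF.
  have r0 : 0 < (2^-1 : R) ^+ k.+1 by rewrite exprn_gt0// invr_gt0.
  have -> : young_rate p q ^+ k.+1 = (2^-1 ^+ k.+1) `^ (1 + (p / q - p)).
    rewrite /young_rate -powR_mulrn ?powR_ge0// -powRrM mulrC powRrM.
    by rewrite powR_mulrn ?invr_ge0// addrA.
  rewrite powRD; last by rewrite (gt_eqF r0) implybT.
  by rewrite powRr1 ?(ltW r0)// /eps; ring.
apply: slice_integral_le => //.
- by move=> a [].
(* A point of height [0] is the root, which is an ancestor of [tree_A] and so never active. *)
- move=> a [[[nA _] _] _]; rewrite lt_neqAle hgt_ge0 andbT; apply/eqP => h; apply: nA.
  rewrite (_ : a = tree_O w); last first.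
    by apply/esym; apply: mdist_positivity; rewrite -/(hgt a) -h.
  by rewrite /anc -/(hgt _) /hgt mdistxx subr0.
- move=> l ul la lS; apply: (antichain_bound s0 st t1 p1 q1 P0 Q0 (eps0 k) wP rQ ul la).
  by move=> a /lS[[? ?] [? _]].
Qed.

Let slice_trivIset : trivIset setT slice.
Proof.
apply/trivIsetP => i j _ _; wlog ij : i j / (i < j)%N.
  move=> H; rewrite neq_lt => /orP[ij|ji]; first by apply: H; rewrite ?neq_lt ?ij.
  by rewrite setIC; apply: H; rewrite ?neq_lt ?ji.
move=> _; apply/seteqP; split => // a [[_ [ti _]] [_ [_ ntj]]]; apply: ntj.
apply: tall_le ti; rewrite eps2 /eps ler_pM2l//.
by apply: ler_wiXn2l => //; rewrite ?invr_ge0 ?invf_le1//; lra.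
Qed.

Let osc x y : s <= x <= t -> s <= y <= t -> w y - w x <= P.
Proof.
move=> sx sy; apply: (le_trans (ler_norm _)); apply: (@powR_le_cancel p) => //.
- exact: lt_le_trans ltr01 p1.
- exact: ltW.
- exact: (var_le_osc wP).
Qed.

Let slice_cover : both `\` @leaves R w = \bigcup_k slice k.
Proof.
rewrite leavesE setDE setCK; apply/seteqP; split => a; last first.
  by move=> [k _ [ba [ta _]]]; split => //; apply: tall_le ta; exact: ltW.
move=> [ba [x x01 [ax]]]; rewrite addr0 => h.
have [|n hn] := @dyadic_small P (hgt (tp w x) - hgt a) P0; first by rewrite subr_gt0.
have hex : exists n, `[< tall (P * 2^-1 ^+ n) a >].
  by exists n; apply/asboolP; exists x => //; split => //; lra.
(* The least [n] for which [a] is tall at scale [P / 2 ^ n] gives the slice. It is not [0], by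
   [osc], so it is [k + 1], and minimality fails the scale [2 * eps k]. *)
case: (ex_minnP hex) => -[|k] /asboolP tk kmin.
  exfalso; move: tk => [y y01 [ay]]; rewrite expr0 mulr1.
  case: (ba) => -[nA /andP[sf ft]] [nB /andP[sl lt]].
  have /andP[fy yl] := act_both_witness ba.1 ba.2 y01 ay.
  rewrite -{1}(tp_tfirst a) !hgt_tp ?tfirst01// => hy.
  have := @osc (tfirst a) y ltac:(lra) ltac:(lra); lra.
exists k => //; split => //; split => //; rewrite eps2 => tk'.
by have := kmin k; rewrite ltnn => /(_ (asboolT tk')).
Qed.

Let both_le : (\int[lam]_(a in both) (g a)%:E <=
  (2 * P * Q / (1 - young_rate p q))%:E)%E.
Proof.
have mgE (D : set TB) : measurable_fun D (fun a => (g a)%:E).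
  by apply: measurable_funTS; exact/measurable_EFinP.
have mleaves : measurable (@leaves R w : set TB).
  by rewrite leavesE; apply: measurableC; exact: tall_measurable.
rewrite (@ge0_negligible_integral _ _ _ lam both (@leaves R w))//; last first.
- exact: hlam.1.
- by move=> a _; rewrite lee_fin.
rewrite [X in integral _ X _](_ : _ = \bigcup_k slice k); last exact: slice_cover.
rewrite ge0_integral_bigcup//; last by move=> a _; rewrite lee_fin.
apply: lime_le.
  by apply: is_cvg_nneseries => k _ _; apply: integral_ge0 => a _; rewrite lee_fin.
apply: nearW => n.
apply: (@le_trans _ _ (\sum_(0 <= k < n) (2 * P * Q * young_rate p q ^+ k.+1)%:E)%E).
  by apply: lee_sum => k _; exact: slice_le.
rewrite sumEFin lee_fin -mulr_sumr ler_pM2l ?mulr_gt0//.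
exact: geometric_sum_le (young_rate_itv p1 q1 pq).
Qed.

Let only_t : set TB := ancestors (tp w t) `\` ancestors (tp w s).
(** The added point is the exception in [actR_only]; it has length zero. *)
Let only_s : set TB := (ancestors (tp w s) `\` ancestors (tp w t)) `|` [set tp w t].

Let monly_t : measurable only_t.
Proof. by apply: measurableD; exact: ancestors_measurable. Qed.

Let monly_s : measurable only_s.
Proof.
apply: measurableU; last exact: set1_tree_measurable.
by apply: measurableD; exact: ancestors_measurable.
Qed.

Let length_only x y : 0 <= x <= 1 -> 0 <= y <= 1 -> s <= x <= t -> s <= y <= t ->
  (lam (ancestors (tp w y) `\` ancestors (tp w x)) <= P%:E)%E.
Proof.
move=> x01 y01 sx sy; rewrite length_ancD// lee_fin.
have [c cxy cP] := argmin_btw w x01 y01; rewrite (path_minE x01 y01 cxy cP).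
by apply: osc => //; move: cxy sx sy; rewrite /btw; lra.
Qed.

Let length_only_t : (lam only_t <= P%:E)%E.
Proof. by apply: length_only; rewrite ?lexx ?st. Qed.

Let length_only_s : (lam only_s <= P%:E)%E.
Proof.
apply: (@le_trans _ _ (lam (ancestors (tp w s) `\` ancestors (tp w t)) + lam [set tp w t])%E).
  apply: measureU2; last exact: set1_tree_measurable.
  by apply: measurableD; exact: ancestors_measurable.
rewrite length_set1// adde0.
by apply: length_only; rewrite ?lexx ?st.
Qed.

(** The integrand is at most [g] where both times count and at most [S] where one does; the latter
    points lie in [only_t] or [only_s], each of length at most [P]. *)
Lemma drho_integral_le :
  (\int[lam]_(a in [set: TB]) `|Drho w (fun x => rho x * \1_(`]s, t]) x) a|%:E <=
   (2 * P * Q / (1 - young_rate p q) + 2 * P * S)%:E)%E.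
Proof.
pose h1 := (fun a => (g a)%:E) \_ both.
pose h2 := (cst S%:E : TB -> \bar R) \_ only_t.
pose h3 := (cst S%:E : TB -> \bar R) \_ only_s.
have mh1 : measurable_fun setT h1.
  by apply/(measurable_restrictT _ _).1 => //; apply: measurable_funTS; exact/measurable_EFinP.
have mh2 : measurable_fun setT h2 by apply/(measurable_restrictT _ _).1.
have mh3 : measurable_fun setT h3 by apply/(measurable_restrictT _ _).1.
have h10 a : (0 <= h1 a)%E by rewrite /h1 patchE; case: ifP => // _; rewrite lee_fin.
have h20 a : (0 <= h2 a)%E by rewrite /h2 patchE; case: ifP => // _; rewrite lee_fin.
have h30 a : (0 <= h3 a)%E by rewrite /h3 patchE; case: ifP => // _; rewrite lee_fin.
apply: (@le_trans _ _ (\int[lam]_(a in [set: TB]) (h1 a + (h2 a + h3 a)))%E).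
  apply: ge0_le_integral => //.
  - by apply/measurable_EFinP; apply: measurableT_comp => //; exact: Drho_indic_measurable.
  - by apply: emeasurable_funD => //; exact: emeasurable_funD.
  move=> a _; rewrite Drho_indic.
  have [L|nL] := pselect (actL s t a); have [Rr|nR] := pselect (actR s t a).
  - rewrite (asboolT L) (asboolT Rr).
    rewrite [leLHS](_ : _ = h1 a); last by rewrite /h1 patchE mem_set.
    by rewrite leeDl// adde_ge0.
  - rewrite (asboolT L) (asboolF nR) subr0.
    have [hat nas] := actL_only s0 st t1 L nR.
    apply: (@le_trans _ _ (h2 a)).
      rewrite /h2 patchE mem_set//= lee_fin rS//.
      by case: L => _ /andP[/ltW -> ->].
    by rewrite addeCA leeDl// adde_ge0.
  - rewrite (asboolF nL) (asboolT Rr) sub0r normrN.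
    apply: (@le_trans _ _ (h3 a)).
      rewrite /h3 patchE mem_set//=.
        by rewrite lee_fin rS//; case: Rr => _ /andP[/ltW -> ->].
      have [at_|at_] := pselect (a = tp w t); [by right|left].
      by have [] := actR_only s0 st t1 Rr nL at_.
    by rewrite addeA leeDr// adde_ge0.
  - by rewrite (asboolF nL) (asboolF nR) subr0 normr0 !adde_ge0.
rewrite ge0_integralD//; last 2 first.
- by move=> a _; rewrite adde_ge0.
- exact: emeasurable_funD.
rewrite ge0_integralD// /h1 /h2 /h3 -!integral_mkcond !integral_cst//.
rewrite EFinD; apply: leeD; first exact: both_le.
rewrite (_ : 2 * P * S = S * P + S * P); last by ring.
rewrite EFinD; apply: leeD; rewrite EFinM; apply: lee_pmul => //.
Qed.

End main_bound.

(** * Subdivisions *)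

Section subdivisions.
Context {R : realType}.
Implicit Types (f : R -> R) (p q s t u x y e M : R) (r : seq R).

(** Continuous induction: let [sup T] bound the times up to which [e] admits a modulus. Continuity
    at [sup T] extends the modulus to [v], beyond [sup T] unless [1] is reached. *)
Lemma cont01_uniform f e : cont01 f -> 0 < e -> exists2 d, 0 < d &
  forall x y, 0 <= x <= 1 -> 0 <= y <= 1 -> `|x - y| < d -> `|f x - f y| < e.
Proof.
move=> cf e0; pose good t := exists2 d, 0 < d &
  forall x y, 0 <= x <= t -> 0 <= y <= t -> `|x - y| < d -> `|f x - f y| < e.
pose T := [set t | 0 <= t <= 1 /\ good t].
have T0 : T 0.
  split; first by rewrite lexx ler01.
  exists 1 => // x y x0 y0 _; have -> : x = 0 by lra.
  have -> : y = 0 by lra.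
  by rewrite subrr normr0.
have hT : has_sup T by split; [exists 0|exists 1 => t [/andP[]]].
have T1 : sup T <= 1 by apply: ge_sup; [exists 0|move=> t [/andP[]]].
have sT0 : 0 <= sup T by apply: ub_le_sup => //; case: hT.
have s01 : 0 <= sup T <= 1 by rewrite sT0.
have [|d0 d00 dP] := cf _ s01 (e / 2); first by lra.
have [|t [t01 [dt dt0 dtP]] st] := @sup_adherent _ T (d0 / 2) _ hT; first by lra.
have ts : t <= sup T by apply: ub_le_sup; [case: hT|split => //; exists dt].
pose v := Num.min 1 (sup T + d0 / 2).
have [v1 v2] : v <= 1 /\ v <= sup T + d0 / 2 by split; rewrite /v ge_min lexx ?orbT.
have v0 : 0 <= v by rewrite /v le_min; lra.
have Tv : T v.
  split; first by rewrite v0.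
  exists (Num.min dt (d0 / 2)); first by rewrite lt_min; lra.
  move=> x y xv yv; rewrite lt_min => /andP[xydt xyd0].
  have far z z' : 0 <= z <= v -> 0 <= z' <= v -> `|z - z'| < d0 / 2 -> t < z ->
      `|f z - f z'| < e.
    rewrite ltr_norml => zv zv' zz tz.
    have := dP z; have := dP z'; rewrite !ltr_norml.
    by move=> /(_ ltac:(lra) ltac:(lra)) ? /(_ ltac:(lra) ltac:(lra)) ?; lra.
  have [xt|tx] := leP x t; last exact: far.
  have [yt|ty] := leP y t; last by rewrite distrC; apply: far => //; rewrite distrC.
  by apply: dtP => //; lra.
have vs : v <= sup T by apply: ub_le_sup => //; case: hT.
have v_1 : v = 1.
  by move: vs v1 v2; rewrite /v /Num.min; case: ltP => // *; lra.
by have [_ [d d1 H]] := Tv; exists d => // x y ? ?; apply: H; rewrite v_1.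
Qed.

Lemma subdiv_pt_itv r i : itv_partition 0 1 r -> (i < size r)%N ->
  [/\ 0 <= subdiv_pt r i, subdiv_pt r i < subdiv_pt r i.+1 & subdiv_pt r i.+1 <= 1].
Proof.
move=> r01 ir; split.
- by apply: (itv_partition_nth_ge _ r01); exact: leqW.
- by have [/(pathP 1)/(_ i ir)] := r01.
- exact: (itv_partition_nth_le _ r01).
Qed.

Lemma subdiv_pt_in r i : itv_partition 0 1 r -> (i <= size r)%N -> 0 <= subdiv_pt r i <= 1.
Proof.
move=> r01 ir; rewrite (itv_partition_nth_ge _ r01)//.
by rewrite (itv_partition_nth_le _ r01).
Qed.

Lemma subdiv_pt_size r : itv_partition 0 1 r -> subdiv_pt r (size r) = 1.
Proof. exact: itv_partition_nth_size. Qed.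

Lemma mesh_ge r i : (i < size r)%N -> subdiv_pt r i.+1 - subdiv_pt r i <= mesh r.
Proof.
move=> ir; rewrite /mesh big_mkord.
exact: (le_bigmax 0 (fun i : 'I_(size r) => subdiv_pt r i.+1 - subdiv_pt r i) (Ordinal ir)).
Qed.

Let psum p f s r : R :=
  \sum_(0 <= i < size r) `|f (nth 1 (s :: r) i.+1) - f (nth 1 (s :: r) i)| `^ p.

Let psum_cons p f s x r : psum p f s (x :: r) = `|f x - f s| `^ p + psum p f x r.
Proof. by rewrite /psum /= big_nat_recl. Qed.

Let intervals_partition p f s l : 0 < p -> intervals s 1 l ->
  exists2 r, itv_partition s 1 r & power_sum p f l <= psum p f s r.
Proof.
move=> p0; have prep x y r M : x <= y -> itv_partition y 1 r -> M <= psum p f y r ->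
    exists2 r', itv_partition x 1 r' & `|f y - f x| `^ p + M <= psum p f x r'.
  move=> xy yr Mr; move: xy; rewrite le_eqVlt => /orP[/eqP ->|xy].
    by exists r => //; rewrite subrr normr0 powR0 ?add0r// gt_eqF.
  exists (y :: r); last by rewrite psum_cons lerD2l.
  by case: yr => yr lr; split => //=; rewrite xy.
elim: l s => [s /= s1|x l ih s /= /and3P[sx xx /ih[r r1 rl]]].
  have [||r r1 h] := @prep s 1 [::] 0 s1; first by split => /=.
    by rewrite /psum big_geq.
  exists r => //; apply: le_trans h; rewrite /power_sum big_nil addr0; exact: powR_ge0.
have [r' r1' h] := prep _ _ _ _ xx r1 rl.
have [r'' r1'' h'] := prep _ _ _ _ sx r1' h.
exists r'' => //; apply: le_trans h'; rewrite /power_sum big_cons lerDr; exact: powR_ge0.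
Qed.

Lemma pvar_var_le p f V : 0 < p -> (pvar p f <= V%:E)%E -> var_le p f 0 1 V.
Proof.
move=> p0 fV l /(@intervals_partition p f 0 l p0)[r r1 rl].
apply: le_trans rl _; rewrite -lee_fin; apply: le_trans fV.
by apply: ereal_sup_ubound; exists r.
Qed.

Lemma pvar_ge0 p f : (0 <= pvar p f)%E.
Proof.
apply: (@le_trans _ _ (\sum_(0 <= i < size [:: 1 : R])
   `|f (subdiv_pt [:: 1] i.+1) - f (subdiv_pt [:: 1] i)| `^ p)%:E).
  by rewrite lee_fin; apply: sumr_ge0 => *; exact: powR_ge0.
by apply: ereal_sup_ubound; exists [:: 1] => //; exact: itv_partition1.
Qed.

(** Nonconstancy matters when [V_q(rho)] is infinite: a vanishing [V_p(w)] would make the product in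
    [young_bound] equal to [0] instead of [+oo]. *)
Lemma cpath_pvar_gt0 p (w : cpath R) : 0 < p -> (0 < pvar p w)%E.
Proof.
move=> p0; rewrite lt_neqAle pvar_ge0 andbT; apply/eqP => w0.
have w0' : var_le p w 0 1 0 by apply: pvar_var_le; rewrite // -w0.
have [s [t [s01 t01]]] := cpath_nonconstant w; apply.
move: s01 t01; rewrite !in_itv/= => s01 t01.
have := var_le_osc w0' t01 s01; have := powR_ge0 `|w s - w t| p.
move=> h1 h2; have /eqP : `|w s - w t| `^ p = 0 by lra.
by rewrite powR_eq0 normr_eq0 subr_eq0 => /andP[/eqP].
Qed.

Lemma variation_on_sum_le p f V r n : itv_partition 0 1 r -> (n <= size r)%N ->
  var_le p f 0 1 V ->
  \sum_(0 <= i < n) variation_on p f (subdiv_pt r i) (subdiv_pt r i.+1) <= V.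
Proof.
move=> r01 nr fV.
have step m : (m <= size r)%N ->
    \sum_(0 <= i < m) variation_on p f (subdiv_pt r i) (subdiv_pt r i.+1) <=
    variation_on p f 0 (subdiv_pt r m).
  elim: m => [_|m ih mr].
    by rewrite big_geq// (@variation_on_ge0 _ _ _ _ _ V)// => l h;
       apply: fV; apply: intervals_widen h; rewrite // /subdiv_pt /= ler01.
  have [h0 h1 h2] := subdiv_pt_itv r01 mr.
  rewrite big_nat_recr//=; apply: le_trans (lerD (ih (ltnW mr)) (lexx _)) _.
  apply: (@variation_on_superadd _ _ _ _ _ _ V) => //; first exact: ltW.
  exact: var_le_sub fV.
have /andP[n0 n1] := subdiv_pt_in r01 nr.
apply: le_trans (step n nr) _; apply: variation_on_le => //.
exact: var_le_sub fV.
Qed.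

(** After normalization by [A] and [B], [Y <= 1] and [b >= 1 - a] give [Y ^ b <= Y ^ (1 - a)]; then
    [X ^ a * Y ^ (1 - a) <= a X + (1 - a) Y] is summed. This covers [a + b > 1], as the Young
    condition requires. *)
Lemma hoelder_sum_le (x y : nat -> R) (a b A B : R) n : 0 < a -> a < 1 -> 0 < b -> 1 <= a + b ->
  0 < A -> 0 < B -> (forall i, (i < n)%N -> 0 <= x i) -> (forall i, (i < n)%N -> 0 <= y i) ->
  \sum_(0 <= i < n) x i <= A -> \sum_(0 <= i < n) y i <= B ->
  \sum_(0 <= i < n) x i `^ a * y i `^ b <= A `^ a * B `^ b.
Proof.
move=> a0 a1 b0 ab A0 B0 x0 y0 xA yB.
have AB0 : 0 < A `^ a * B `^ b by rewrite mulr_gt0 ?powR_gt0.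
have le_sum (z : nat -> R) C i : (forall i, (i < n)%N -> 0 <= z i) -> (i < n)%N ->
    \sum_(0 <= j < n) z j <= C -> z i <= C.
  move=> z0 i_n; apply: le_trans; rewrite big_mkord (bigD1 (Ordinal i_n))//= lerDl.
  by apply: sumr_ge0 => j _; exact: z0.
have key i : (i < n)%N ->
    x i `^ a * y i `^ b <= A `^ a * B `^ b * (a * (x i / A) + (1 - a) * (y i / B)).
  move=> i_n; have [xi yi] := (x0 i i_n, y0 i i_n).
  set X := x i / A; set Y := y i / B.
  have X0 : 0 <= X by rewrite divr_ge0// ltW.
  have Y0 : 0 <= Y by rewrite divr_ge0// ltW.
  have Y1 : Y <= 1 by rewrite ler_pdivrMr// mul1r; exact: le_sum yB.
  have -> : x i `^ a * y i `^ b = A `^ a * B `^ b * (X `^ a * Y `^ b).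
    rewrite mulrACA -!powRM ?(ltW A0) ?(ltW B0)//.
    by rewrite /X /Y ![_ * (_ / _)]mulrC !divfK ?gt_eqF.
  rewrite ler_pM2l//.
  apply: (@le_trans _ _ (X `^ a * Y `^ (1 - a))).
    apply: ler_wpM2l; first exact: powR_ge0.
    have [->|Yn0] := eqVneq Y 0; first by rewrite powR0 ?gt_eqF// powR_ge0.
    have Yp : 0 < Y by rewrite lt_neqAle eq_sym Yn0.
    have a1' : 0 < 1 - a by lra.
    have -> : b = (1 - a) * (b / (1 - a)) by rewrite mulrCA divff ?mulr1// gt_eqF.
    rewrite powRrM; apply: ge1r_powR; last by rewrite ler_pdivlMr//; lra.
    rewrite powR_gt0//=; apply: (@le_trans _ _ (1 `^ (1 - a))); last by rewrite powR1.
    by apply: ge0_ler_powR; rewrite ?nnegrE// ltW.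
  have a1' : 0 < 1 - a by lra.
  have := @conjugate_powR R (X `^ a) (Y `^ (1 - a)) a^-1 (1 - a)^-1 (powR_ge0 _ _) (powR_ge0 _ _).
  rewrite !invrK -!powRrM !divff ?gt_eqF// !powRr1// [X * a]mulrC [Y * _]mulrC; apply.
  - by rewrite invr_gt0.
  - by rewrite invr_gt0.
  - by ring.
apply: (@le_trans _ _ (\sum_(0 <= i < n)
    A `^ a * B `^ b * (a * (x i / A) + (1 - a) * (y i / B)))).
  by rewrite big_nat [leRHS]big_nat; apply: ler_sum => i; exact: key.
rewrite -mulr_sumr ler_piMr ?(ltW AB0)// big_split/= -!mulr_sumr -!mulr_suml.
have xA1 : (\sum_(0 <= i < n) x i) / A <= 1 by rewrite ler_pdivrMr// mul1r.
have yB1 : (\sum_(0 <= i < n) y i) / B <= 1 by rewrite ler_pdivrMr// mul1r.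
have h1 : a * ((\sum_(0 <= i < n) x i) / A) <= a * 1 by rewrite ler_pM2l.
have h2 : (1 - a) * ((\sum_(0 <= i < n) y i) / B) <= (1 - a) * 1 by rewrite ler_wpM2l//; lra.
lra.
Qed.

End subdivisions.

(** * Choice of exponents and limiting bounds *)

Section exponents.
Context {R : realType}.
Implicit Types (rho : R -> R) (w : cpath R).

Lemma sup_norm_ge rho x : bounded_borel rho -> 0 <= x <= 1 -> `|rho x| <= sup_norm rho.
Proof.
move=> [_ [M [_ rM]]] x01; apply: ub_le_sup; last by exists x; rewrite //= in_itv.
exists (M + 1) => _ [y y01 <-]; apply: (rM (M + 1)) => //.
by rewrite ltrDl.
Qed.

Lemma var_index_ge1 (f : R -> R) : (1 <= var_index f)%E.
Proof. by apply: le_ereal_inf_tmp => _ [p [p1 _] <-]; rewrite lee_fin. Qed.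

(** The indices need not be attained. With [m] strictly between [1] and the sum of their inverses,
    exponents of finite variation exist below [m] times each index, and their inverses still add up
    to more than [1]. An infinite index is impossible, as the other inverse is at most [1]. *)
Lemma young_pair_exponents (w rho : R -> R) : young_pair w rho ->
  exists p q, [/\ 1 <= p, 1 <= q, 1 < p^-1 + q^-1, (pvar p w < +oo)%E & (pvar q rho < +oo)%E].
Proof.
rewrite /young_pair; have := var_index_ge1 w; have := var_index_ge1 rho.
have inv_le1 (r : R) : 1 <= r -> (r%:E^-1 <= 1 :> \bar R)%E.
  by move=> r1; rewrite inver gt_eqF ?lee_fin ?invf_le1//; lra.
case wE : (var_index w) => [a| |] //; case rE : (var_index rho) => [b| |] //; last first.
- by rewrite !invey adde0 ltNge lee_fin ler01.
- by rewrite invey add0e lee_fin => /inv_le1 h _; rewrite ltNge h.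
- by move=> _; rewrite invey adde0 lee_fin => /inv_le1 h; rewrite ltNge h.
rewrite !lee_fin => b1 a1; rewrite !inver !gt_eqF ?(lt_le_trans ltr01)//.
rewrite -EFinD lte_fin => ab.
pose m := (1 + (a^-1 + b^-1)) / 2.
have m1 : 1 < m by rewrite /m; lra.
have pick (f : R -> R) c : 1 <= c -> var_index f = c%:E ->
    exists p, [/\ 1 <= p, (pvar p f < +oo)%E & c^-1 / m < p^-1].
  move=> c1 fc; have : (var_index f < (c * m)%:E)%E.
    by rewrite fc lte_fin ltr_pMr//; lra.
  move=> /ereal_inf_lt[_ [p [p1 fp] <-]]; rewrite lte_fin => pc; exists p; split => //.
  have cm : 0 < c * m by rewrite mulr_gt0//; lra.
  by rewrite -invfM ltf_pV2 ?posrE//; lra.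
have [p [p1 wp ap]] := pick w a a1 wE; have [q [q1 rq bq]] := pick rho b b1 rE.
exists p, q; split => //.
apply: le_lt_trans (ltrD ap bq); rewrite -mulrDl ler_pdivlMr; last by lra.
by rewrite mul1r /m; lra.
Qed.

(** The slicing needs [P] and [Q] positive, whereas variations may vanish on a subinterval; bounds
    for all larger values pass to the limit. Increasing both by [d <= 1] costs at most [d * c]. *)
Lemma le_of_gt_bounds (X : \bar R) (A B P Q : R) : 0 <= A -> 0 <= B -> 0 <= P -> 0 <= Q ->
  (forall P' Q', P < P' -> Q < Q' -> (X <= (A * P' * Q' + P' * B)%:E)%E) ->
  (X <= (A * P * Q + P * B)%:E)%E.
Proof.
move=> A0 B0 P0 Q0 H; apply/lee_addgt0Pr => e e0; rewrite -EFinD.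
pose c := A * (P + Q + 1) + B.
have c0 : 0 <= c by rewrite addr_ge0// mulr_ge0//; lra.
pose d := Num.min 1 (e / (c + 1)).
have d0 : 0 < d by rewrite lt_min ltr01 divr_gt0//; lra.
have d1 : d <= 1 by rewrite ge_min lexx.
have de : d * (c + 1) <= e by rewrite -ler_pdivlMr ?ge_min ?lexx ?orbT//; lra.
apply: le_trans (H (P + d) (Q + d) _ _) _; rewrite ?ltrDl// lee_fin.
have : d * (d * A) <= d * A by rewrite -[leRHS]mul1r ler_wpM2r// mulr_ge0// ltW.
have : 0 <= d * 1 by lra.
move: de; rewrite /c; lra.
Qed.

End exponents.

(** * Linearity, and integrals of [Drho] over the tree *)

Section Drho_linearity.
Context {R : realType} (w : cpath R).
Implicit Types (f g : R -> R).

Lemma DrhoD f g a : Drho w (fun x => f x + g x) a = Drho w f a + Drho w g a.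
Proof.
have key (b b' : bool) (x x' y y' : R) :
    (if b then 0 else x + x') - (if b' then 0 else y + y') =
    ((if b then 0 else x) - (if b' then 0 else y)) +
    ((if b then 0 else x') - (if b' then 0 else y')) by case: b; case: b'; ring.
exact: key.
Qed.

Lemma DrhoB f g a : Drho w (fun x => f x - g x) a = Drho w f a - Drho w g a.
Proof.
have key (b b' : bool) (x x' y y' : R) :
    (if b then 0 else x - x') - (if b' then 0 else y - y') =
    ((if b then 0 else x) - (if b' then 0 else y)) -
    ((if b then 0 else x') - (if b' then 0 else y')) by case: b; case: b'; ring.
exact: key.
Qed.

End Drho_linearity.

Section tree_integrals.
Context {R : realType} (w : cpath R) (lam : {measure set (tree_borel w) -> \bar R}).
Hypothesis hlam : length_measure lam.
Local Notation TB := (tree_borel w).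
Implicit Types (rho : R -> R) (s t u p q : R).

Lemma Drho_integral_le rho s t p q V W S : measurable_fun (`[0, 1] : set R) rho ->
  0 <= s -> s <= t -> t <= 1 -> 1 <= p -> 1 <= q -> 1 < p^-1 + q^-1 ->
  var_le p w s t V -> var_le q rho s t W -> (forall x, s <= x <= t -> `|rho x| <= S) ->
  (\int[lam]_(a in [set: TB]) `|Drho w (fun x => rho x * \1_(`]s, t]) x) a|%:E <=
   (young_const p q * V `^ p^-1 * (W `^ q^-1 + S))%:E)%E.
Proof.
move=> mrho s0 st t1 p1 q1 pq wV rW rS.
have V0 := var_le_ge0 st wV; have W0 := var_le_ge0 st rW.
have S0 : 0 <= S by apply: le_trans (rS s _); rewrite ?lexx.
have [c1 c2] := young_const_ge p1 q1 pq; have /andP[z0 z1] := young_rate_itv p1 q1 pq.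
set A := 2 / (1 - young_rate p q) in c1.
have A0 : 0 <= A by rewrite divr_ge0//; lra.
have root_lt (r M N : R) : 1 <= r -> 0 <= M -> M `^ r^-1 < N -> M <= N `^ r.
  move=> r1 M0 MN; have r0 : 0 < r by lra.
  rewrite -[leLHS]powRr1// -(mulVf (lt0r_neq0 r0)).
  rewrite powRrM; apply: ge0_ler_powR; rewrite ?nnegrE ?powR_ge0//; first by lra.
    exact: le_trans (powR_ge0 _ _) (ltW MN).
  exact: ltW.
apply: (@le_trans _ _ (A * V `^ p^-1 * W `^ q^-1 + V `^ p^-1 * (2 * S))%:E).
  apply: le_of_gt_bounds => //; [by rewrite mulr_ge0|exact: powR_ge0|exact: powR_ge0|].
  move=> P Q VP WQ.
  have P0 : 0 < P := le_lt_trans (powR_ge0 _ _) VP.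
  have Q0 : 0 < Q := le_lt_trans (powR_ge0 _ _) WQ.
  rewrite (_ : A * P * Q + P * (2 * S) = 2 * P * Q / (1 - young_rate p q) + 2 * P * S).
    apply: (@drho_integral_le R w lam hlam rho s t p q P Q S) => //.
      by apply: var_le_W wV; exact: root_lt VP.
    by apply: var_le_W rW; exact: root_lt WQ.
  by rewrite /A; ring.
rewrite lee_fin; have := powR_ge0 V p^-1; have := powR_ge0 W q^-1.
set P := V `^ _; set Q := W `^ _ => Q0 P0.
have : 0 <= (young_const p q - A) * (P * Q) by rewrite mulr_ge0 ?mulr_ge0//; lra.
have : 0 <= (young_const p q - 2) * (P * S) by rewrite mulr_ge0 ?mulr_ge0//; lra.
lra.
Qed.

Lemma Drho_indic_integrable rho s t p q V W S : measurable_fun (`[0, 1] : set R) rho ->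
  0 <= s -> s <= t -> t <= 1 -> 1 <= p -> 1 <= q -> 1 < p^-1 + q^-1 ->
  var_le p w s t V -> var_le q rho s t W -> (forall x, s <= x <= t -> `|rho x| <= S) ->
  lam.-integrable [set: TB] (fun a => (Drho w (fun x => rho x * \1_(`]s, t]) x) a)%:E).
Proof.
move=> mrho s0 st t1 p1 q1 pq wV rW rS; apply/integrableP; split.
  by apply/measurable_EFinP; exact: Drho_indic_measurable.
apply: le_lt_trans (ltry (young_const p q * V `^ p^-1 * (W `^ q^-1 + S))).
exact: Drho_integral_le.
Qed.

Lemma tree_integral_abs_le (f : R -> R) C :
  lam.-integrable [set: TB] (fun a => (Drho w f a)%:E) ->
  (\int[lam]_(a in [set: TB]) `|Drho w f a|%:E <= C)%E ->
  (`|tree_integral lam f|%:E <= C)%E.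
Proof.
move=> fi fC; rewrite /tree_integral EFin_normr_Rintegral//.
apply: le_trans fC; apply: le_trans (le_abse_integral _ _ _) _ => //.
by case/integrableP: fi.
Qed.

Lemma tree_integral_on_le rho s t p q V W S : measurable_fun (`[0, 1] : set R) rho ->
  0 <= s -> s <= t -> t <= 1 -> 1 <= p -> 1 <= q -> 1 < p^-1 + q^-1 ->
  var_le p w s t V -> var_le q rho s t W -> (forall x, s <= x <= t -> `|rho x| <= S) ->
  `|tree_integral_on lam s t rho| <= young_const p q * V `^ p^-1 * (W `^ q^-1 + S).
Proof.
move=> mrho s0 st t1 p1 q1 pq wV rW rS; rewrite -lee_fin.
apply: tree_integral_abs_le; first exact: Drho_indic_integrable wV rW rS.
exact: Drho_integral_le.
Qed.

Lemma ae_eq_off2 (f g : TB -> \bar R) b b' :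
  (forall a, a <> b -> a <> b' -> f a = g a) -> ae_eq lam [set: TB] f g.
Proof.
move=> fg; exists [set b; b']; split.
- by apply: measurableU; exact: set1_tree_measurable.
- apply/eqP; rewrite -measure_le0.
  apply: (@le_trans _ _ (lam [set b] + lam [set b'])%E).
    by apply: measureU2; exact: set1_tree_measurable.
  by rewrite !length_set1// adde0.
- move=> a /= /not_implyP[_ nh]; apply: contrapT => nab; apply: nh.
  by apply: fg => ab; apply: nab; [left|right].
Qed.

Lemma ancestors_integrable b c :
  lam.-integrable [set: TB] (fun a => (c * \1_(ancestors b) a)%:E).
Proof.
apply/integrableP; split.
  apply/measurable_EFinP; apply: measurable_funM => //; apply: measurable_indic.
  exact: ancestors_measurable.
rewrite (_ : (fun a => _) = (fun a => `|c|%:E * (\1_(ancestors b) a)%:E)%E); last first.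
  by apply/funext => a; rewrite /= normrM EFinM [`|\1_ _ _|]ger0_norm// indicE.
rewrite ge0_integralZl//; last first.
  by apply/measurable_EFinP; apply: measurable_indic; exact: ancestors_measurable.
rewrite integral_indic ?setIT//; last exact: ancestors_measurable.
by rewrite length_ancestors// -EFinM ltry.
Qed.

Lemma tree_integral_cst c s t : 0 <= s -> s <= t -> t <= 1 ->
  lam.-integrable [set: TB] (fun a => (Drho w (fun x => c * \1_(`]s, t]) x) a)%:E) /\
  tree_integral_on lam s t (cst c) = c * (w t - w s).
Proof.
move=> s0 st t1.
have s01 : 0 <= s <= 1 by lra.
have t01 : 0 <= t <= 1 by lra.
pose h (a : TB) : R := c * \1_(ancestors (tp w t)) a - c * \1_(ancestors (tp w s)) a.
have mc : measurable_fun (`[0, 1] : set R) (cst c) by exact: measurable_cst.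
have mD := @Drho_indic_measurable R w (cst c) s t mc.
have hi : lam.-integrable [set: TB] (fun a => (h a)%:E).
  under eq_fun do rewrite EFinB.
  by apply: integrableB => //; exact: ancestors_integrable.
have hE a : a <> tp w s -> a <> tp w t -> h a = Drho w (fun x => c * \1_(`]s, t]) x) a.
  move=> as_ at_; rewrite (Drho_indic (cst c)) /h !indicE -mulrBr.
  have -> : (a \in ancestors (tp w t))%:R - (a \in ancestors (tp w s))%:R =
      `[<anc a (tp w t)>]%:R - `[<anc a (tp w s)>]%:R :> R by [].
  rewrite -(act_indic s0 st t1 as_ at_).
  by case: asboolP => _; case: asboolP => _ /=; ring.
have Di : lam.-integrable [set: TB] (fun a => (Drho w (fun x => c * \1_(`]s, t]) x) a)%:E).
  apply/integrableP; split; first exact/measurable_EFinP.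
  case/integrableP: hi => mh; congr (_ < _)%E.
  apply: (@ae_eq_integral _ _ _ lam) => //.
  - exact: measurableT_comp.
  - by apply: measurableT_comp => //; exact/measurable_EFinP.
  - by apply: (@ae_eq_off2 _ _ (tp w s) (tp w t)) => a as_ at_; rewrite hE.
split => //; transitivity (\int[lam]_(a in [set: TB]) h a).
  congr fine; apply: ae_eq_integral => //; try by [case/integrableP: hi|case/integrableP: Di].
  by apply: (@ae_eq_off2 _ _ (tp w s) (tp w t)) => a as_ at_; rewrite hE.
rewrite RintegralB//; try exact: ancestors_integrable.
have hI b : \int[lam]_(a in [set: TB]) (c * \1_(ancestors b) a) = c * hgt b.
  rewrite RintegralZl//.
    congr (_ * _); rewrite /Rintegral integral_indic ?setIT//; last exact: ancestors_measurable.
    by rewrite length_ancestors.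
  have := ancestors_integrable b 1; congr (lam.-integrable _ _).
  by apply/funext => a; rewrite /= mul1r.
by rewrite !hI !hgt_tp//; ring.
Qed.

Lemma tree_integral01 rho : measurable_fun (`[0, 1] : set R) rho ->
  tree_integral_on lam 0 1 rho = tree_integral lam rho.
Proof.
move=> mrho; congr fine; apply: ae_eq_integral => //.
- by apply/measurable_EFinP; exact: Drho_indic_measurable.
- by apply/measurable_EFinP; exact: Drho_measurable.
- apply: (@ae_eq_off2 _ _ (tree_A w) (tree_A w)) => a aA _.
  by rewrite [in RHS]Drho_indic01.
Qed.

Lemma Drho_abs_integral01 rho : measurable_fun (`[0, 1] : set R) rho ->
  (\int[lam]_(a in [set: TB]) `|Drho w (fun x => rho x * \1_(`]0%R, 1%R]) x) a|%:E =
   \int[lam]_(a in [set: TB]) `|Drho w rho a|%:E)%E.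
Proof.
move=> mrho; apply: ae_eq_integral => //.
- by apply/measurable_EFinP; apply: measurableT_comp => //; exact: Drho_indic_measurable.
- by apply/measurable_EFinP; apply: measurableT_comp => //; exact: Drho_measurable.
- apply: (@ae_eq_off2 _ _ (tree_A w) (tree_A w)) => a aA _.
  by rewrite [in RHS]Drho_indic01.
Qed.

Lemma indic_itv_split (s u t x : R) : s <= u -> u <= t ->
  \1_(`]s, t]) x = \1_(`]s, u]) x + \1_(`]u, t]) x :> R.
Proof.
move=> su ut; rewrite !indicE.
have memE y z : (x \in [set` `]y, z]]) = (y < x <= z).
  by apply/idP/idP => [/set_mem|h]; [rewrite /= in_itv|rewrite mem_set//= in_itv].
rewrite !memE; case: (leP x u) => xu.
  by rewrite (le_trans xu ut)/= addr0.
by rewrite (le_lt_trans su xu) andbF add0r.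
Qed.

Lemma tree_integral_chasles rho s u t :
  s <= u -> u <= t ->
  lam.-integrable [set: TB] (fun a => (Drho w (fun x => rho x * \1_(`]s, u]) x) a)%:E) ->
  lam.-integrable [set: TB] (fun a => (Drho w (fun x => rho x * \1_(`]u, t]) x) a)%:E) ->
  tree_integral_on lam s t rho = tree_integral_on lam s u rho + tree_integral_on lam u t rho.
Proof.
move=> su ut isu iut; rewrite /tree_integral_on /tree_integral -RintegralD//.
apply: eq_Rintegral => a _; rewrite -DrhoD; congr (Drho w _ a).
by apply/funext => x; rewrite (indic_itv_split x su ut) mulrDr.
Qed.

End tree_integrals.

(** * Young integral *)

Section young_estimates.
Context {R : realType}.
Implicit Types (rho : R -> R) (w : cpath R) (p q : R).

(** Because [+oo * 0 = 0] in [\bar R], an infinite [V_p(w)] does not always make the bound infinite: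
    the last factor may be zero, which forces [rho = 0] on [[0, 1]]. Hence the separate hypothesis
    for that case. *)
Lemma young_bound_intro C p q w rho (X : \bar R) : 0 < C -> 1 <= p -> 1 <= q ->
  bounded_borel rho ->
  (forall V U, pvar p w = V%:E -> pvar q rho = U%:E ->
    (X <= (C * V `^ p^-1 * (U `^ q^-1 + sup_norm rho))%:E)%E) ->
  ((forall x, 0 <= x <= 1 -> rho x = 0) -> (X <= 0)%E) ->
  (X <= young_bound C p q w rho)%E.
Proof.
move=> C0 p1 q1 hrho hfin hzero; rewrite /young_bound.
have p0 : 0 < p by exact: lt_le_trans p1.
have q0 : 0 < q by exact: lt_le_trans q1.
have pV0 : p^-1 != 0 by rewrite invr_eq0 gt_eqF.
have qV0 : q^-1 != 0 by rewrite invr_eq0 gt_eqF.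
have S0 : 0 <= sup_norm rho.
  by apply: le_trans (sup_norm_ge hrho (_ : 0 <= 0 <= 1)); rewrite ?lexx ?ler01.
have wpos := cpath_pvar_gt0 w p0; have rpos := pvar_ge0 q rho.
case wE : (pvar p w) wpos => [V| |] // V0.
  case rE : (pvar q rho) rpos => [U| |] // U0.
    by rewrite !poweR_EFin -EFinD -!EFinM; exact: hfin.
  rewrite poweRyr// addye// gt0_muley ?leey//.
  by rewrite poweR_EFin -EFinM lte_fin mulr_gt0// powR_gt0.
rewrite poweRyr// gt0_muley ?lte_fin//.
have Z0 : (0 <= pvar q rho `^ q^-1 + (sup_norm rho)%:E)%E.
  by rewrite adde_ge0 ?poweR_ge0// lee_fin.
have [Zp|Zn] := ltP 0%E (pvar q rho `^ q^-1 + (sup_norm rho)%:E)%E.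
  by rewrite gt0_mulye// leey.
have Z : (pvar q rho `^ q^-1 + (sup_norm rho)%:E = 0)%E by apply/eqP; rewrite eq_le Zn.
rewrite Z mule0; apply: hzero => x x01; apply/eqP; rewrite -normr_le0.
have : ((sup_norm rho)%:E <= 0)%E by rewrite -Z leeDr// poweR_ge0.
by rewrite lee_fin; exact: le_trans (sup_norm_ge hrho x01).
Qed.

Lemma bounded_var_exponents w rho : young_pair w rho -> exists p q V U,
  [/\ 1 <= p, 1 <= q, 1 < p^-1 + q^-1, var_le p w 0 1 V & var_le q rho 0 1 U].
Proof.
move=> /young_pair_exponents[p [q [p1 q1 pq wp rq]]].
have p0 : 0 < p by exact: lt_le_trans p1.
have q0 : 0 < q by exact: lt_le_trans q1.
exists p, q, (fine (pvar p w)), (fine (pvar q rho)); split => //.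
  by apply: pvar_var_le => //; rewrite fineK// ge0_fin_numE// pvar_ge0.
by apply: pvar_var_le => //; rewrite fineK// ge0_fin_numE// pvar_ge0.
Qed.

Lemma young_const_gt0 p q : 1 <= p -> 1 <= q -> 1 < p^-1 + q^-1 -> 0 < young_const p q.
Proof. by move=> p1 q1 pq; have [_] := young_const_ge p1 q1 pq; apply: lt_le_trans. Qed.

Lemma Drho_eq0 w rho : (forall x, 0 <= x <= 1 -> rho x = 0) -> Drho w rho = cst 0.
Proof.
move=> r0; apply/funext => a; rewrite /Drho !r0 ?tfirst01 ?tlast01//.
have key (b b' : bool) : (if b then 0 else 0) - (if b' then 0 else 0) = 0 :> R.
  by case: b; case: b'; rewrite subrr.
exact: key.
Qed.

(** Each increment satisfies [x ^ p' <= d ^ (p' - p) * x ^ p]. *)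
Lemma var_le_interpolate (f : R -> R) p p' s t M d : 0 < p -> p <= p' -> 0 <= d ->
  var_le p f s t M -> (forall x y, s <= x <= t -> s <= y <= t -> `|f y - f x| <= d) ->
  var_le p' f s t (d `^ (p' - p) * M).
Proof.
move=> p0 pp d0 fM fd l sl.
apply: (@le_trans _ _ (d `^ (p' - p) * power_sum p f l)); last first.
  by apply: ler_wpM2l; [exact: powR_ge0|exact: fM].
have inside x : x \in l -> s <= x.1 <= t /\ s <= x.2 <= t.
  elim: l s sl {fM fd} => // y l ih s /= /and3P[sy yy yl].
  have yt := intervals_le yl.
  rewrite inE => /orP[/eqP ->|/(ih _ yl)]; first by lra.
  by lra.
rewrite /power_sum mulr_sumr big_seq [leRHS]big_seq; apply: ler_sum => x xl.
have [x1 x2] := inside x xl.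
have [->|dx0] := eqVneq `|f x.2 - f x.1| 0.
  by rewrite powR0 ?mulr_ge0 ?powR_ge0// gt_eqF//; exact: lt_le_trans pp.
rewrite {1}(_ : p' = (p' - p) + p); last by ring.
rewrite powRD ?dx0 ?implybT//; apply: ler_wpM2r; first exact: powR_ge0.
by apply: ge0_ler_powR; rewrite ?nnegrE ?subr_ge0//; exact: fd.
Qed.

End young_estimates.

(** * The integral against [w]: bounds, Chasles relation, Riemann sums *)

Section young_integral.
Context {R : realType} (w : cpath R) (lam : {measure set (tree_borel w) -> \bar R}).
Hypothesis hlam : length_measure lam.
Local Notation TB := (tree_borel w).
Variable rho : R -> R.
Hypothesis hrho : bounded_borel rho.

Let mrho : measurable_fun (`[0, 1] : set R) rho := hrho.1.

Let rho_le s t x : 0 <= s -> t <= 1 -> s <= x <= t -> `|rho x| <= sup_norm rho.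
Proof. by move=> s0 t1 sxt; apply: sup_norm_ge => //; lra. Qed.

Lemma Drho_integral_young_bound p q : 1 <= p -> 1 <= q -> 1 < p^-1 + q^-1 ->
  (\int[lam]_(a in [set: TB]) `|Drho w rho a|%:E <=
   young_bound (young_const p q) p q w rho)%E.
Proof.
move=> p1 q1 pq; apply: young_bound_intro => //; first exact: young_const_gt0.
  move=> V U wV rU; rewrite -Drho_abs_integral01//.
  apply: Drho_integral_le => //.
  - by apply: pvar_var_le; [exact: lt_le_trans p1|rewrite wV].
  - by apply: pvar_var_le; [exact: lt_le_trans q1|rewrite rU].
  - by move=> x; exact: rho_le.
move=> r0; rewrite Drho_eq0//.
by under eq_integral do rewrite normr0; rewrite integral0.
Qed.

Section young_pair.
Hypothesis wrho : young_pair w rho.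

Lemma Drho_itv_integrable s t : 0 <= s -> s <= t -> t <= 1 ->
  lam.-integrable [set: TB] (fun a => (Drho w (fun x => rho x * \1_(`]s, t]) x) a)%:E).
Proof.
move=> s0 st t1; have [p [q [V [U [p1 q1 pq wV rU]]]]] := bounded_var_exponents wrho.
apply: (@Drho_indic_integrable _ _ _ hlam rho s t p q V U (sup_norm rho)) => //.
- exact: var_le_sub wV.
- exact: var_le_sub rU.
- by move=> x; exact: rho_le.
Qed.

Lemma Drho_integrable : lam.-integrable [set: TB] (fun a => (Drho w rho a)%:E).
Proof.
apply/integrableP; split; first by apply/measurable_EFinP; exact: Drho_measurable.
under eq_integral do rewrite /=.
rewrite -(Drho_abs_integral01 hlam mrho).
by have /integrableP[] := Drho_itv_integrable (lexx 0) ler01 (lexx 1).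
Qed.

Lemma chasles s u t : 0 <= s -> s <= u -> u <= t -> t <= 1 ->
  tree_integral_on lam s t rho = tree_integral_on lam s u rho + tree_integral_on lam u t rho.
Proof.
move=> s0 su ut t1; apply: tree_integral_chasles => //.
  by apply: Drho_itv_integrable => //; exact: le_trans t1.
by apply: Drho_itv_integrable => //; exact: le_trans su.
Qed.

(** By [chasles] an increment is an integral over a subinterval, at most [K] times the local
    [V_p(w) ^ (1/p)]; only [w] is localized, [rho] being bounded globally in [K]. The [p]-th powers
    then add up by superadditivity. *)
Lemma primitive_variation_le p q : 1 <= p -> 1 <= q -> 1 < p^-1 + q^-1 ->
  (pvar p (fun t => tree_integral_on lam 0 t rho) `^ p^-1 <=
   young_bound (young_const p q) p q w rho)%E.
Proof.
move=> p1 q1 pq; have p0 : 0 < p by exact: lt_le_trans p1.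
have q0 : 0 < q by exact: lt_le_trans q1.
have C0 := young_const_gt0 p1 q1 pq.
apply: young_bound_intro => //; last first.
  move=> r0; suff -> : pvar p (fun t => tree_integral_on lam 0 t rho) = 0%E.
    by rewrite poweR0r// invr_eq0 gt_eqF.
  apply/eqP; rewrite eq_le pvar_ge0 andbT; apply: ge_ereal_sup => _ [r _ <-].
  rewrite lee_fin big1// => i _; rewrite /tree_integral_on /tree_integral.
  rewrite !Drho_eq0; try by move=> x x01; rewrite r0// mul0r.
  by rewrite subrr normr0 powR0// gt_eqF.
move=> V U wV rU; set K := young_const p q * (U `^ q^-1 + sup_norm rho).
have wV' : var_le p w 0 1 V by apply: pvar_var_le; rewrite // wV.
have rU' : var_le q rho 0 1 U by apply: pvar_var_le; rewrite // rU.
have V0 := var_le_ge0 ler01 wV'.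
have S0 : 0 <= sup_norm rho.
  by apply: le_trans (sup_norm_ge hrho (_ : 0 <= 0 <= 1)); rewrite ?lexx ?ler01.
have K0 : 0 <= K by rewrite mulr_ge0 ?(ltW C0)// addr_ge0// powR_ge0.
have -> : young_const p q * V `^ p^-1 * (U `^ q^-1 + sup_norm rho) = (V * K `^ p) `^ p^-1.
  rewrite powRM ?powR_ge0// -powRrM mulfV ?gt_eqF// powRr1// /K; ring.
rewrite -poweR_EFin; apply: gt0_ler_poweR.
- by rewrite invr_ge0 ltW.
- by rewrite in_itv/= pvar_ge0 leey.
- by rewrite in_itv/= lee_fin mulr_ge0 ?powR_ge0//= leey.
apply: ge_ereal_sup => _ [r r01 <-]; rewrite lee_fin.
apply: (@le_trans _ _ (\sum_(0 <= i < size r)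
    variation_on p w (subdiv_pt r i) (subdiv_pt r i.+1) * K `^ p)).
  rewrite big_nat [leRHS]big_nat; apply: ler_sum => i /andP[_ ir].
  have [i0 ii i1] := subdiv_pt_itv r01 ir.
  have wi := variation_onP (ltW ii) (var_le_sub i0 i1 wV').
  rewrite (chasles (lexx 0) i0 (ltW ii) i1) addrAC subrr add0r.
  have -> : variation_on p w (subdiv_pt r i) (subdiv_pt r i.+1) * K `^ p =
      (variation_on p w (subdiv_pt r i) (subdiv_pt r i.+1) `^ p^-1 * K) `^ p.
    rewrite powRM ?powR_ge0// -powRrM mulVf ?gt_eqF// powRr1//.
    exact: var_le_ge0 (ltW ii) wi.
  apply: ge0_ler_powR; rewrite ?nnegrE ?(ltW p0)//.
    by apply: mulr_ge0 => //; exact: powR_ge0.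
  rewrite /K mulrCA mulrA.
  apply: tree_integral_on_le => //; first exact: ltW.
  - exact: var_le_sub rU'.
  - by move=> x; exact: rho_le.
by rewrite -mulr_suml ler_wpM2r ?powR_ge0// variation_on_sum_le.
Qed.

(** The Riemann term is the integral of the constant [rho xi], so the error is the integral of
    [rho - rho xi]. Its supremum on [[s, t]] is at most [W ^ (1/q)], which replaces the sup norm and
    gives the factor [2]. *)
Lemma riemann_term_le s t xi p q V W : 0 <= s -> s <= t -> t <= 1 ->
  1 <= p -> 1 <= q -> 1 < p^-1 + q^-1 -> var_le p w s t V -> var_le q rho s t W ->
  s <= xi <= t ->
  `|rho xi * (w t - w s) - tree_integral_on lam s t rho| <=
    2 * young_const p q * (V `^ p^-1 * W `^ q^-1).
Proof.
move=> s0 st t1 p1 q1 pq wV rW sxi.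
have W0 := var_le_ge0 st rW; have q0 : 0 < q by exact: lt_le_trans q1.
have [ic cE] := tree_integral_cst hlam (rho xi) s0 st t1.
have -> : rho xi * (w t - w s) - tree_integral_on lam s t rho =
    - tree_integral_on lam s t (fun x => rho x - rho xi).
  rewrite -cE /tree_integral_on /tree_integral.
  have -> : Drho w (fun x => (rho x - rho xi) * \1_(`]s, t]) x) = fun a =>
      Drho w (fun x => rho x * \1_(`]s, t]) x) a -
      Drho w (fun x => cst (rho xi) x * \1_(`]s, t]) x) a.
    apply/funext => a; rewrite -DrhoB; congr (Drho w _ a).
    by apply/funext => x; rewrite mulrBl.
  rewrite RintegralB//; first by rewrite opprB.
  exact: Drho_itv_integrable.
rewrite normrN (_ : 2 * young_const p q * (V `^ p^-1 * W `^ q^-1) =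
  young_const p q * V `^ p^-1 * (W `^ q^-1 + W `^ q^-1)); last by ring.
apply: tree_integral_on_le => //.
- by apply: measurable_funB.
- move=> l sl; have := rW l sl; rewrite /power_sum.
  by under [X in _ -> X <= _]eq_bigr do rewrite opprB addrA subrK.
- move=> x sx; apply: (@powR_le_cancel _ q) => //; first exact: powR_ge0.
  rewrite -powRrM mulVf ?gt_eqF// powRr1//.
  exact: var_le_osc rW _ _.
Qed.

Lemma tree_integral_sum r : itv_partition 0 1 r ->
  \sum_(0 <= i < size r) tree_integral_on lam (subdiv_pt r i) (subdiv_pt r i.+1) rho =
  tree_integral lam rho.
Proof.
move=> r01; rewrite -(tree_integral01 hlam mrho) -(subdiv_pt_size r01).
have : (size r <= size r)%N by [].
elim: {1 3 4}(size r) => [_|m ih mr].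
  (* With all three times equal to [0], the relation says that the integral over []0, 0]]
     vanishes. *)
  have := chasles (lexx 0) (lexx 0) (lexx 0) ler01; rewrite big_geq// /subdiv_pt /=; lra.
have [m0 mm m1] := subdiv_pt_itv r01 mr.
by rewrite big_nat_recr//= ih ?(ltnW mr)// -chasles// ltW.
Qed.

Lemma riemann_stieltjes_limit e : 0 < e -> exists2 eta : R, 0 < eta &
  forall (r : seq R) (xi : nat -> R), itv_partition 0 1 r -> mesh r < eta ->
    (forall i : nat, (i < size r)%N -> subdiv_pt r i <= xi i <= subdiv_pt r i.+1) ->
    `|RS_sum w rho r xi - tree_integral lam rho| < e.
Proof.
move=> e0; have [p [q [V [U [p1 q1 pq wV rU]]]]] := bounded_var_exponents wrho.
have p0 : 0 < p by exact: lt_le_trans p1.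
have q0 : 0 < q by exact: lt_le_trans q1.
have V0 := var_le_ge0 ler01 wV; have U0 := var_le_ge0 ler01 rU.
(* The spare room in [1 < p^-1 + q^-1] allows a larger exponent [p'] for [w]: its
   [p']-variation on small intervals is controlled by a power of the oscillation. *)
pose m := (1 + (p^-1 + q^-1)) / 2; have m1 : 1 < m by rewrite /m; lra.
pose p' := p * m; have pp : p < p' by rewrite /p' ltr_pMr.
have p'0 : 0 < p' := lt_trans p0 pp.
have p'1 : 1 < p' := le_lt_trans p1 pp.
have pq' : 1 < p'^-1 + q^-1.
  have qm : q^-1 / m <= q^-1.
    by rewrite ler_pdivrMr ?(lt_trans ltr01)// ler_peMr ?invr_ge0 ?ltW.
  apply: lt_le_trans (lerD (lexx _) qm).
  by rewrite /p' invfM -mulrDl ltr_pdivlMr ?(lt_trans ltr01)// mul1r /m; lra.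
pose k := (p' - p) / p'; have k0 : 0 < k by rewrite divr_gt0// subr_gt0.
have C0 := young_const_gt0 (ltW p'1) q1 pq'.
(* [V + 1] and [U + 1] because [hoelder_sum_le] wants positive bounds. *)
pose M := 2 * young_const p' q * ((V + 1) `^ p'^-1 * (U + 1) `^ q^-1).
have M0 : 0 < M by rewrite !mulr_gt0// powR_gt0//; lra.
(* Chosen so that [d ^ k * M = e / 2]: the total error is at most [d ^ k * M] when [w] oscillates by
   at most [d] on each interval. *)
pose d := (e / (2 * M)) `^ k^-1.
have d0 : 0 < d by rewrite powR_gt0// divr_gt0// mulr_gt0.
have dM : d `^ k * M < e.
  rewrite /d -powRrM mulVf ?gt_eqF// powRr1; last by rewrite divr_ge0// ltW// mulr_gt0.
  have -> : e / (2 * M) * M = e / 2 by field; exact: lt0r_neq0.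
  by lra.
have [eta eta0 etaP] := cont01_uniform (cpath_cont01 w) d0.
exists eta => // r xi r01 reta xiP; apply: le_lt_trans dM.
rewrite -(tree_integral_sum r01) /RS_sum -sumrB.
apply: le_trans (ler_norm_sum _ _ _) _.
pose x i := variation_on p w (subdiv_pt r i) (subdiv_pt r i.+1).
pose y i := variation_on q rho (subdiv_pt r i) (subdiv_pt r i.+1).
apply: (@le_trans _ _ (\sum_(0 <= i < size r)
    2 * young_const p' q * d `^ k * (x i `^ p'^-1 * y i `^ q^-1))).
  rewrite big_nat [leRHS]big_nat; apply: ler_sum => i /andP[_ ir].
  have [i0 ii i1] := subdiv_pt_itv r01 ir.
  have wi := variation_onP (ltW ii) (var_le_sub i0 i1 wV).
  have ri := variation_onP (ltW ii) (var_le_sub i0 i1 rU).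
  have x0 : 0 <= x i := var_le_ge0 (ltW ii) wi.
  have wi' : var_le p' w (subdiv_pt r i) (subdiv_pt r i.+1) (d `^ (p' - p) * x i).
    apply: var_le_interpolate => //; [exact: ltW|exact: ltW|].
    move=> z z' iz iz'; apply/ltW/etaP; [lra|lra|].
    by have := mesh_ge ir; rewrite ltr_norml; lra.
  have := riemann_term_le i0 (ltW ii) i1 (ltW p'1) q1 pq' wi' ri (xiP i ir).
  rewrite (powRM _ (powR_ge0 _ _) x0) -powRrM -/k.
  by move/le_trans; apply; rewrite -/(y i) -!mulrA.
rewrite -mulr_sumr (_ : d `^ k * M =
  2 * young_const p' q * d `^ k * ((V + 1) `^ p'^-1 * (U + 1) `^ q^-1)); last first.
  by rewrite /M; ring.
apply: ler_wpM2l; first by rewrite !mulr_ge0 ?powR_ge0// ltW.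
apply: hoelder_sum_le.
- by rewrite invr_gt0.
- by rewrite invf_lt1.
- by rewrite invr_gt0.
- exact: ltW.
- by lra.
- by lra.
- move=> i ir; have [i0 ii i1] := subdiv_pt_itv r01 ir.
  exact: variation_on_ge0 (ltW ii) (var_le_sub i0 i1 wV).
- move=> i ir; have [i0 ii i1] := subdiv_pt_itv r01 ir.
  exact: variation_on_ge0 (ltW ii) (var_le_sub i0 i1 rU).
- by apply: le_trans (variation_on_sum_le r01 (leqnn _) wV) _; rewrite lerDl.
- by apply: le_trans (variation_on_sum_le r01 (leqnn _) rU) _; rewrite lerDl.
Qed.

End young_pair.
End young_integral.

Theorem theorem4p1 (R : realType) :
  (forall p q : R, 1 <= p -> 1 <= q -> 1 < p^-1 + q^-1 ->
    exists C : R, forall (w : cpath R) (lam : {measure set (tree_borel w) -> \bar R})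
      (rho : R -> R), length_measure lam -> bounded_borel rho ->
      (\int[lam]_(a in [set: tree_borel w]) `|Drho w rho a|%:E
        <= young_bound C p q w rho)%E) /\
  (forall (w : cpath R) (lam : {measure set (tree_borel w) -> \bar R})
     (rho : R -> R), length_measure lam -> bounded_borel rho -> young_pair w rho ->
     lam.-integrable [set: tree_borel w] (fun a => (Drho w rho a)%:E)) /\
  (forall p q : R, 1 <= p -> 1 <= q -> 1 < p^-1 + q^-1 ->
    exists C : R, forall (w : cpath R) (lam : {measure set (tree_borel w) -> \bar R})
      (rho : R -> R), length_measure lam -> bounded_borel rho -> young_pair w rho ->
      (`|tree_integral lam rho|%:E <= young_bound C p q w rho)%E) /\
  (forall (w : cpath R) (lam : {measure set (tree_borel w) -> \bar R})
     (rho : R -> R), length_measure lam -> bounded_borel rho -> young_pair w rho ->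
     forall e : R, 0 < e -> exists2 eta : R, 0 < eta &
       forall (t : seq R) (s : nat -> R), itv_partition 0 1 t -> mesh t < eta ->
         (forall i : nat, (i < size t)%N ->
            subdiv_pt t i <= s i <= subdiv_pt t i.+1) ->
         `|RS_sum w rho t s - tree_integral lam rho| < e) /\
  (forall (w : cpath R) (lam : {measure set (tree_borel w) -> \bar R})
     (rho : R -> R), length_measure lam -> bounded_borel rho -> young_pair w rho ->
     (forall s t : R, 0 <= s -> s <= t -> t <= 1 ->
        lam.-integrable [set: tree_borel w]
          (fun a => (Drho w (fun x => rho x * \1_(`]s, t]) x) a)%:E)) /\
     (forall s u t : R, 0 <= s -> s <= u -> u <= t -> t <= 1 ->
        tree_integral_on lam s t rho =
        tree_integral_on lam s u rho + tree_integral_on lam u t rho)) /\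
  (forall p q : R, 1 <= p -> 1 <= q -> 1 < p^-1 + q^-1 ->
    exists C : R, forall (w : cpath R) (lam : {measure set (tree_borel w) -> \bar R})
      (rho : R -> R), length_measure lam -> bounded_borel rho -> young_pair w rho ->
      (pvar p (fun t => tree_integral_on lam 0 t rho) `^ p^-1
        <= young_bound C p q w rho)%E).
Proof.
split; first by move=> p q p1 q1 pq; exists (young_const p q) => w lam rho hlam hrho;
  exact: Drho_integral_young_bound.
split; first by move=> w lam rho hlam hrho wrho; exact: Drho_integrable.
split.
  move=> p q p1 q1 pq; exists (young_const p q) => w lam rho hlam hrho wrho.
  apply: tree_integral_abs_le; first exact: Drho_integrable.
  exact: Drho_integral_young_bound.
split; first by move=> w lam rho hlam hrho wrho e; exact: riemann_stieltjes_limit.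
split.
  move=> w lam rho hlam hrho wrho; split=> [s t|s u t]; first exact: Drho_itv_integrable.
  exact: chasles.
by move=> p q p1 q1 pq; exists (young_const p q) => w lam rho hlam hrho wrho;
  exact: primitive_variation_le.
Qed.
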